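(* Let $n\ge2$, $l\in\mathbb Z$, $u\in\tilde S_n$ and $1\le r\le n-1$. Then $$h_r(x)\,\mathrm{Strong}_u(x)=\sum_{u\rightsquigarrow z}\mathrm{Strong}_z(x),$$ where the sum is over weak strips $u\rightsquigarrow z$ of size $r$.
   Context: $h_r$ is the complete homogeneous symmetric function. Affine symmetric group. Fix an integer $n\ge2$; $\overline a$ denotes the class of $a\in\mathbb Z$ in $\mathbb Z/n\mathbb Z$. $\tilde S_n$ is the group under composition of bijections $w:\mathbb Z\to\mathbb Z$ with $w(i+n)=w(i)+n$ for all $i$ and $\sum_{i=1}^n(w(i)-i)=0$. For $\overline r\ne\overline s$, $t_{r,s}\in\tilde S_n$ exchanges $r$ and $s$ and fixes all $i$ with $\overline i\notin\{\overline r,\overline s\}$. The simple reflections are $s_i=t_{i,i+1}$ (depending only on $\overline i$), and $\ell(w)$ is the minimal number of simple reflections in a factorization of $w$. Strong tableaux (depending on the fixed $l\in\mathbb Z$). Write $w\lessdot u$ if $\ell(u)=\ell(w)+1$ and $u=wt_{i,j}$ for some $t_{i,j}$. A marked strong cover $C$ consists of $w,u\in\tilde S_n$ and an ordered pair $(i,j)\in\mathbb Z^2$ with $w\lessdot u$, $u=wt_{i,j}$ and $i\le l<j$; $\mathrm{ins}(C)=w$, $\mathrm{out}(C)=u$, and marking $m(C)=w(j)=u(i)$. A strong strip from $w$ to $u$ is a sequence $(C_1,\dots,C_k)$, $k\ge0$, of marked strong covers forming a chain from $w$ to $u$ (consecutive covers satisfy $\mathrm{out}(C_a)=\mathrm{ins}(C_{a+1})$;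 $w=u$ if $k=0$) with $m(C_1)<\dots<m(C_k)$; its size is $k$. A strong tableau $T$ of shape $u$ is a sequence of strong strips, each starting where the previous one ends, almost all of size $0$, starting at $\mathrm{id}$ and ending at $u$; $\mathrm{wt}(T)$ is the sequence of sizes. $\mathrm{Strong}_u(x)=\sum_Tx^{\mathrm{wt}(T)}$ over strong tableaux $T$ of shape $u$. Weak strips. For a proper cyclic interval $I=\{a,a+1,\dots,b\}\subsetneq\mathbb Z/n\mathbb Z$ let $c_I=s_bs_{b-1}\cdots s_a$. For $A\subsetneq\mathbb Z/n\mathbb Z$ let $c_A$ be the product of the (pairwise commuting) $c_I$ over the maximal cyclic intervals $I$ of $A$. A weak strip $w\rightsquigarrow v$ is a pair $w,v\in\tilde S_n$ such that $v=c_Aw$ and $\ell(v)=\ell(w)+|A|$ for some $A\subsetneq\mathbb Z/n\mathbb Z$; its size is $|A|$. *)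

(* Defs.v *)
From HB Require Import structures.
From mathcomp Require Import all_boot all_order all_algebra.
From mathcomp Require Import finmap.
From mathcomp Require Import boolp classical_sets functions cardinality fsbigop.
From mathcomp Require Import filter ring.

Set Implicit Arguments.
Unset Strict Implicit.
Unset Printing Implicit Defensive.

Import Order.TTheory GRing.Theory Num.Theory.
Local Open Scope classical_set_scope.
Local Open Scope ring_scope.

Definition is_affine (n : nat) (w : int -> int) : Prop :=
  [/\ bijective w,
      forall i : int, w (i + n%:Z) = w i + n%:Z
    & \sum_(1 <= i < n.+1) (w i%:Z - i%:Z) = 0].

Record affperm (n : nat) := AffPerm {
  aff_fun :> int -> int;
  aff_funP : `[< is_affine n aff_fun >] }.

HB.instance Definition _ (n : nat) := [isSub for @aff_fun n].
HB.instance Definition _ (n : nat) := [Choice of affperm n by <:].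

Lemma is_affineP n (w : affperm n) : is_affine n w.
Proof. exact/asboolP/aff_funP. Qed.

Lemma affperm_eq n (v w : affperm n) : (forall i, v i = w i) -> v = w.
Proof. by move=> vw; apply/val_inj/funext. Qed.

Section Periodic.
Variables (n : nat) (w : int -> int).
Hypothesis wn : forall i : int, w (i + n%:Z) = w i + n%:Z.

Lemma periodicM (i k : int) : w (i + k * n%:Z) = w i + k * n%:Z.
Proof.
have wp (m : nat) j : w (j + m%:Z * n%:Z) = w j + m%:Z * n%:Z.
  elim: m j => [|m IH] j; first by rewrite !mul0r !addr0.
  by rewrite -addn1 PoszD !mulrDl !mul1r !addrA wn IH.
case: k => m; first exact: wp.
rewrite NegzE; set k := m.+1.
by apply: (addIr (k%:Z * n%:Z)); rewrite -wp -!addrA mulNr addNr !addr0.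
Qed.

Lemma periodic_mod (i : int) : w i - i = w (i %% n)%Z - (i %% n)%Z.
Proof.
rewrite {1 2}(divz_eq i n) [_ * _ + _]addrC periodicM.
by rewrite opprD addrACA subrr addr0.
Qed.
End Periodic.

(* The window 1, ..., n in the sum condition can be replaced by the residues
   0, ..., n - 1. *)
Lemma sum_window n (w : int -> int) :
    (forall i : int, w (i + n%:Z) = w i + n%:Z) ->
  \sum_(1 <= i < n.+1) (w i%:Z - i%:Z) = \sum_(i < n) (w i%:Z - i%:Z).
Proof.
case: n => [|n] wn; first by rewrite big_ord0 big_geq.
rewrite big_add1 /= -(big_mkord xpredT (fun i : nat => w i%:Z - i%:Z)).
rewrite big_nat_recr //= [RHS]big_nat_recl //= addrC; congr (_ + _).
by rewrite -{1 2}[n.+1%:Z]add0r wn subr0 add0r addrK.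
Qed.

Lemma is_affine_id n : is_affine n id.
Proof.
split=> //; first by exists id.
by rewrite big1 // => i _; rewrite subrr.
Qed.

Lemma sum_residues n (v f : int -> int) :
    is_affine n v -> (forall i, f i = f (i %% n)%Z) ->
  \sum_(i < n) f (v i%:Z) = \sum_(i < n) f i%:Z.
Proof.
case: n => [|n] [vbij vn _] fn; first by rewrite !big_ord0.
have vmod i : (v i %% n.+1)%Z = (v (i %% n.+1)%Z %% n.+1)%Z.
  rewrite {1}(divz_eq i n.+1) addrC periodicM //.
  by rewrite addrC modzMDl.
have ltn i : (`|(i %% n.+1)%Z| < n.+1)%N.
  by rewrite -ltz_nat gez0_abs ?modz_ge0 // ltz_pmod.
have absK i : (`|(i %% n.+1)%Z|)%:Z = (i %% n.+1)%Z.
  by rewrite gez0_abs // modz_ge0.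
pose h (i : 'I_n.+1) : 'I_n.+1 := Ordinal (ltn (v i%:Z)).
have hinj : injective h.
  move=> i j /(congr1 (fun k : 'I_n.+1 => (k : nat)%:Z)).
  rewrite /= !absK => /eqP; rewrite eqz_mod_dvd => /dvdzP[k /eqP].
  rewrite subr_eq addrC -periodicM // => /eqP /(bij_inj vbij) ij.
  apply: val_inj; apply: (congr1 absz (_ : i%:Z = j%:Z)).
  have: (i%:Z %% n.+1 = j%:Z %% n.+1)%Z by rewrite ij addrC modzMDl.
  by rewrite !modz_small // ltz_nat ltn_ord.
rewrite [RHS](reindex_inj hinj) /=; apply: eq_bigr => i _.
by rewrite absK -fn.
Qed.

Lemma is_affine_comp n (v w : int -> int) :
  is_affine n v -> is_affine n w -> is_affine n (v \o w).
Proof.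
move=> [vb vn vs] wA; have [wb wn ws] := wA.
have vwn i : (v \o w) (i + n%:Z) = (v \o w) i + n%:Z by rewrite /= wn vn.
split=> //; first exact: bij_comp.
rewrite sum_window //.
under eq_bigr => i _ do rewrite /= -(subrKA (w i%:Z)).
rewrite big_split /= -[X in _ + X]sum_window // ws addr0.
by rewrite (@sum_residues n w (fun i => v i - i)) -?sum_window //; apply: periodic_mod.
Qed.

Lemma is_affine_inv n (v w : int -> int) :
  is_affine n v -> cancel v w -> cancel w v -> is_affine n w.
Proof.
move=> vA vK wK; have [vb vn vs] := vA.
have wn i : w (i + n%:Z) = w i + n%:Z by rewrite -{1}[i]wK -vn vK.
split=> //; first by exists v.
rewrite sum_window //.
rewrite -(@sum_residues n v (fun i => w i - i)) //; last exact: periodic_mod.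
under eq_bigr => i _ do rewrite vK -opprB.
by rewrite sumrN -sum_window // vs oppr0.
Qed.

Definition affperm_id n : affperm n :=
  AffPerm (asboolT (is_affine_id n)).

Definition affperm_mul n (v w : affperm n) : affperm n :=
  AffPerm (asboolT (is_affine_comp (is_affineP v) (is_affineP w))).

Lemma affperm_inv_subproof n (v : affperm n) :
  {w : affperm n | cancel v w /\ cancel w v}.
Proof.
apply: cid; have vA := is_affineP v; have [[w vK wK] _ _] := vA.
by exists (AffPerm (asboolT (is_affine_inv vA vK wK))).
Qed.

Definition affperm_inv n (v : affperm n) : affperm n :=
  sval (affperm_inv_subproof v).

Lemma affperm_mulA n : associative (@affperm_mul n).
Proof. by move=> u v w; apply: affperm_eq. Qed.
Lemma affperm_mul1 n : left_id (affperm_id n) (@affperm_mul n).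
Proof. by move=> u; apply: affperm_eq. Qed.
Lemma affperm_mulr1 n : right_id (affperm_id n) (@affperm_mul n).
Proof. by move=> u; apply: affperm_eq. Qed.
Lemma affperm_mulV n :
  left_inverse (affperm_id n) (@affperm_inv n) (@affperm_mul n).
Proof.
move=> u; apply: affperm_eq => i; rewrite /affperm_inv /=.
by case: affperm_inv_subproof => w [].
Qed.
Lemma affperm_mulrV n :
  right_inverse (affperm_id n) (@affperm_inv n) (@affperm_mul n).
Proof.
move=> u; apply: affperm_eq => i; rewrite /affperm_inv /=.
by case: affperm_inv_subproof => w [].
Qed.

HB.instance Definition _ (n : nat) :=
  isGroup.Build (affperm n) (@affperm_mulA n) (@affperm_mul1 n)
    (@affperm_mulr1 n) (@affperm_mulV n) (@affperm_mulrV n).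

(* The guard makes this the identity when r and s are congruent mod n, where
   t_{r,s} is not defined. *)
Definition transp_fun (n : nat) (r s i : int) : int :=
  if (r == s %[mod n])%Z then i
  else if (i == r %[mod n])%Z then i + (s - r)
  else if (i == s %[mod n])%Z then i + (r - s)
  else i.

Lemma sum_residue_eq n (r : int) :
  (0 < n)%N -> \sum_(i < n) (i%:Z == r %[mod n])%Z%:R = 1 :> int.
Proof.
case: n => // n _.
have rn : (`|(r %% n.+1)%Z| < n.+1)%N.
  by rewrite -ltz_nat gez0_abs ?modz_ge0 // ltz_pmod.
have rE : (`|(r %% n.+1)%Z|)%:Z = (r %% n.+1)%Z by rewrite gez0_abs // modz_ge0.
rewrite (bigD1 (Ordinal rn)) //= rE modz_mod eqxx big1 ?addr0 // => i ir.
case: eqP => // ri; case/eqP: ir; apply: val_inj => /=.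
apply: (congr1 absz (_ : i%:Z = `|(r %% n.+1)%Z|%N%:Z)).
by rewrite rE -ri modz_small // ltz_nat ltn_ord.
Qed.

Lemma transp_is_affine n (r s : int) : is_affine n (transp_fun n r s).
Proof.
rewrite /transp_fun; case: (boolP (r == s %[mod n])%Z) => [_|rs].
  exact: is_affine_id.
set f := fun i : int => _.
have fn i : f (i + n%:Z) = f i + n%:Z.
  by rewrite /f !modzDr; do 2?[case: ifP => _]; rewrite // addrAC.
have fr i : (i + (s - r) == s %[mod n])%Z = (i == r %[mod n])%Z.
  by rewrite !eqz_mod_dvd; congr (_ %| _)%Z; ring.
have fs i : (i + (r - s) == r %[mod n])%Z = (i == s %[mod n])%Z.
  by rewrite !eqz_mod_dvd; congr (_ %| _)%Z; ring.
have fK : involutive f.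
  move=> i; rewrite {2}/f; case: ifP => ir; last case: ifP => is_.
  - rewrite /f fr ir; case: ifP => [|_]; last by ring.
    have /eqP -> : (i + (s - r) == s %[mod n])%Z by rewrite fr.
    by rewrite eq_sym (negPf rs).
  - by rewrite /f fs is_; ring.
  - by rewrite /f ir is_.
split=> //; first by exists f.
rewrite sum_window //.
have [->|n0] := posnP n; first by rewrite big_ord0.
under eq_bigr => i _.
  rewrite (_ : f i%:Z - i%:Z = (i%:Z == r %[mod n])%Z%:R * (s - r)
                             + (i%:Z == s %[mod n])%Z%:R * (r - s)); last first.
    rewrite /f; case: ifP => [/eqP ->|_]; last case: ifP => _.
    + by rewrite (negPf rs) mul1r mul0r; ring.
    + by rewrite mul1r mul0r; ring.
    + by rewrite !mul0r; ring.
  over.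
by rewrite big_split /= -!mulr_suml !sum_residue_eq //; ring.
Qed.

Definition transp n (r s : int) : affperm n :=
  AffPerm (asboolT (transp_is_affine n r s)).

Definition simple_refl n (i : 'Z_n) : affperm n :=
  transp n (i : nat)%:Z ((i : nat)%:Z + 1).

(* The simple reflections generate the group when 1 < n, so the default value
   0 is then never used. *)
Definition is_length n (w : affperm n) (k : nat) : Prop :=
  (exists2 s : seq 'Z_n, size s = k & w = (\prod_(i <- s) simple_refl i)%g) /\
  (forall s : seq 'Z_n, w = (\prod_(i <- s) simple_refl i)%g -> (k <= size s)%N).

Definition aff_length n (w : affperm n) : nat := xget 0%N [set k | is_length w k].

Definition strong_cover n (w u : affperm n) : Prop :=
  aff_length u = (aff_length w).+1 /\
  exists i j : int, (i != j %[mod n])%Z /\ u = (w * transp n i j)%g.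

Record cover_data (n : nat) := CoverData {
  ins : affperm n;
  out : affperm n;
  ind : int * int }.
HB.instance Definition _ (n : nat) := gen_eqMixin (cover_data n).
HB.instance Definition _ (n : nat) := gen_choiceMixin (cover_data n).

Definition marked_strong_cover n (l : int) (C : cover_data n) : Prop :=
  let: (i, j) := ind C in
  [/\ strong_cover (ins C) (out C), (i != j %[mod n])%Z,
      out C = (ins C * transp n i j)%g & i <= l < j].

Definition marking n (C : cover_data n) : int := ins C (ind C).2.

Fixpoint is_chain n (w : affperm n) (s : seq (cover_data n)) (u : affperm n) :
    Prop :=
  if s is C :: s' then ins C = w /\ is_chain (out C) s' u else w = u.

Record strip_data (n : nat) := StripData {
  start : affperm n;
  stop : affperm n;
  covers : seq (cover_data n) }.
HB.instance Definition _ (n : nat) := gen_eqMixin (strip_data n).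
HB.instance Definition _ (n : nat) := gen_choiceMixin (strip_data n).

Definition strip_size n (S : strip_data n) : nat := size (covers S).

Definition strong_strip n (l : int) (S : strip_data n) : Prop :=
  [/\ forall C, C \in covers S -> marked_strong_cover l C,
      is_chain (start S) (covers S) (stop S)
    & sorted <%R (map (@marking n) (covers S))].

Definition strong_tableau n (l : int) (u : affperm n) (T : nat -> strip_data n) :
    Prop :=
  [/\ forall k, strong_strip l (T k),
      start (T 0%N) = 1%g,
      forall k, start (T k.+1) = stop (T k)
    & exists N, forall k, (N <= k)%N -> strip_size (T k) = 0%N /\ stop (T k) = u].

(* Formal power series over int in the variables x_0, x_1, ...: the value at m
   is the coefficient of the monomial \prod_k x_k ^ (m k). *)
Definition power_series := {fsfun nat -> nat with 0%N} -> int.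

Definition ps_mul (f g : power_series) : power_series := fun m =>
  \sum_(ab \in [set ab : {fsfun nat -> nat with 0%N} * {fsfun nat -> nat with 0%N}
                 | forall k, m k = (ab.1 k + ab.2 k)%N]) f ab.1 * g ab.2.

Definition complete_hsym (r : nat) : power_series := fun m =>
  (\sum_(k <- finsupp m) m k == r)%N%:R.

(* Only finitely many tableaux have a given shape and weight: there are finitely
   many w of length below that of u, and i <= l < j leaves finitely many (i, j)
   with the given t_{i,j}. *)
Definition Strong n (l : int) (u : affperm n) : power_series := fun m =>
  #|` fset_set [set T | strong_tableau l u T /\
                        forall k, strip_size (T k) = m k] |%:Z.

Definition cdist n (a b : 'Z_n) : nat := (b - a)%R.

(* The cyclic interval {a, a+1, ..., b}. *)
Definition cinterval n (a b : 'Z_n) : {set 'Z_n} :=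
  [set a + k%:R | k : 'I_n & (k <= cdist a b)%N]%SET.

Definition is_cinterval n (I : {set 'Z_n}) : bool :=
  [exists a : 'Z_n, exists b : 'Z_n, I == cinterval a b].

(* c_I = s_b ... s_{a+1} s_a for I = {a, ..., b}. *)
Definition c_interval n (a b : 'Z_n) : affperm n :=
  (\prod_(k <- rev (iota 0 (cdist a b).+1)) simple_refl (a + k%:R)%R)%g.

Definition max_cinterval n (A I : {set 'Z_n}) : bool :=
  maxset (fun J : {set 'Z_n} => is_cinterval J && (J \subset A)) I.

(* A proper cyclic interval determines its endpoints (a, b), so each maximal
   interval of A contributes one factor; these factors commute, so their order
   is irrelevant. *)
Definition c_set n (A : {set 'Z_n}) : affperm n :=
  (\prod_(ab : 'Z_n * 'Z_n | max_cinterval A (cinterval ab.1 ab.2))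
     c_interval ab.1 ab.2)%g.

Definition weak_strip n (w v : affperm n) (r : nat) : Prop :=
  exists A : {set 'Z_n},
    [/\ A \proper [set: 'Z_n]%SET, #|A| = r, v = (c_set A * w)%g
      & aff_length v = (aff_length w + #|A|)%N].

(* Main.v *)
From HB Require Import structures.
From mathcomp Require Import all_boot all_order all_algebra.
From mathcomp Require Import finmap.
From mathcomp Require Import boolp classical_sets functions cardinality fsbigop.
From mathcomp Require Import zify ring.
Require Import Defs.

Set Implicit Arguments.
Unset Strict Implicit.
Unset Printing Implicit Defensive.

Import Order.TTheory GRing.Theory Num.Theory.
Local Open Scope classical_set_scope.
Local Open Scope ring_scope.

(** The theorem is a commutation relation between two operators on the functions
    [F : affperm n -> int]. Let [weak_sum r F u] be the sum of [F z] over the weak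
    strips from [u] to [z] of size [r], and [strong_sum k F u] the sum of [F w]
    over the strong strips from [w] to [u] of size [k]. A coefficient of
    [Strong l u] is the value at [u] of a product of operators [strong_sum k],
    one for each variable, applied to the indicator function of the identity
    ([tab_count_cons], [Strong_tab_count]). The relation is
[[
  weak_sum r o strong_sum k = strong_sum k o weak_sum r
                              + weak_sum (r - 1) o strong_sum (k - 1)   (r < n),
]]
    that is, [D(y) S(x) (1 - x y) = S(x) D(y)] modulo [y ^ n] for the generating
    functions ([weak_sum_strong_sum]). Moving the weak operator through the strips
    of a tableau, each variable [x] gives a factor [1 / (1 - x y)]; at the end the
    weak operator meets the indicator function of the identity, to which only the
    empty weak strip contributes. What remains is the generating function of the
    [h_r] times [Strong l u] ([weak_sum_tab_count], [ps_mul_complete_hsym]).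

    The relation itself is local. Let [d i] be the operator of a weak step by the
    simple reflection at [i], and [X m] the operator of a strong cover with marking
    [m], both carrying their variables. A strong strip has increasing markings, so
    [S] is the product of the factors [T m = 1 + X m] over all integers [m], and
    [D] is the sum of the cyclically decreasing products of the [d i]. Conjugation
    by a simple reflection matches the covers below the end of a weak step with the
    covers that lead to the start of one, except for the reflection itself. Hence
    [d i] commutes with [X m] when [m] is not congruent to [i] or [i + 1], and it
    exchanges [X i] and [X (i + 1)] up to a correction [x y] that depends on whether
    the values [i] and [i + 1] stand to the right of [l]. Together
    with the lifting property and the fact that a cover never jumps over an
    intermediate value at an intermediate position, this gives
[[
  T (p + 1) (T p - x y h p) (1 + d p) = (1 + d p) (T (p + 1) - x y h (p + 1)) T p,
]]
    where [h p] is the indicator function of the elements with [p] to the right of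
    [l] ([exchange_relation]).

    In a cyclically decreasing product the links of the cycle can be distributed
    around any chosen site [p] of the cycle; inserting [T p - x y h p] there, the
    exchange relation moves the site to [p + 1] and one factor of [S] from the left
    to the right ([site_shift]). The one product in which no gap separates the two
    ends has degree [n - 1], and its correction vanishes modulo [y ^ n]; this is
    where [r < n] enters. On a given element [T p - x y h p] is [1] for [p] far to
    the left and [1 - x y] for [p] far to the right, because almost all values stand
    on the expected side of [l]; moving the site through a long segment therefore
    gives the relation ([weak_strong]).

    The facts on lengths come from words: if two values are in the wrong order, the
    reflection exchanging them deletes a letter from any word ([exchange]). *)

(* Linear arithmetic without the congruences, whose nonlinear remainders slow
   it down. *)
Ltac zlia := repeat match goal with H : context[modz _ _] |- _ => clear H end; lia.

Ltac znia := repeat match goal with H : context[modz _ _] |- _ => clear H end; nia.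

(** * Reflections and positions of values *)

Section Transpositions.
Variable n : nat.
Implicit Types (a b c d i k m : int) (u v w : affperm n).

Lemma eqmodP a b : reflect (exists k : int, b = a + k * n) (a == b %[mod n])%Z.
Proof.
rewrite eq_sym eqz_mod_dvd; apply: (iffP dvdzP) => -[k].
  by move=> /eqP; rewrite subr_eq addrC => /eqP ->; exists k.
by move=> ->; exists k; rewrite addrC addKr.
Qed.

Lemma eqmodD a k : (a + k * n == a %[mod n])%Z.
Proof. by rewrite [a + _]addrC modzMDl. Qed.

Lemma eqmodD2r c a b : (a + c == b + c %[mod n])%Z = (a == b %[mod n])%Z.
Proof. by rewrite !eqz_mod_dvd opprD addrACA subrr addr0. Qed.

Lemma affpermD w i k : w (i + k * n) = w i + k * n.
Proof. by have [_ wn _] := is_affineP w; rewrite periodicM. Qed.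

Lemma affperm_inj w : injective w.
Proof. by have [wb _ _] := is_affineP w; exact: bij_inj. Qed.

Lemma affpermM u v i : (u * v)%g i = u (v i). Proof. by []. Qed.

Lemma affperm1 i : (1%g : affperm n) i = i. Proof. by []. Qed.

Lemma affpermK w : cancel w (w^-1)%g.
Proof. by move=> i; rewrite -affpermM mulVg. Qed.

Lemma affpermVK w : cancel (w^-1)%g w.
Proof. by move=> i; rewrite -affpermM mulgV. Qed.

Lemma affperm_eqmod w a b : (w a == w b %[mod n])%Z = (a == b %[mod n])%Z.
Proof.
apply/eqmodP/eqmodP => -[k]; last by move=> ->; exists k; rewrite affpermD.
by rewrite -affpermD => /affperm_inj ->; exists k.
Qed.

Lemma transpE a b c : ~~ (a == b %[mod n])%Z ->
  transp n a b c = if (c == a %[mod n])%Z then c + (b - a)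
                   else if (c == b %[mod n])%Z then c + (a - b) else c.
Proof. by move=> /negPf ab; rewrite /= /transp_fun ab. Qed.

Lemma transp1 a b : (a == b %[mod n])%Z -> transp n a b = 1%g.
Proof. by move=> ab; apply: affperm_eq => i; rewrite /= /transp_fun ab. Qed.

Lemma transpL a b : ~~ (a == b %[mod n])%Z -> transp n a b a = b.
Proof. by move=> ab; rewrite transpE // eqxx; ring. Qed.

Lemma transpR a b : ~~ (a == b %[mod n])%Z -> transp n a b b = a.
Proof. by move=> ab; rewrite transpE // eq_sym (negPf ab) eqxx; ring. Qed.

Lemma transpN a b c : ~~ (c == a %[mod n])%Z -> ~~ (c == b %[mod n])%Z ->
  transp n a b c = c.
Proof. by move=> /negPf ca /negPf cb; rewrite /= /transp_fun ca cb; case: ifP. Qed.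

Lemma transpJ w a b : ~~ (a == b %[mod n])%Z ->
  (w * transp n a b = transp n (w a) (w b) * w)%g.
Proof.
move=> ab; have wab : ~~ (w a == w b %[mod n])%Z by rewrite affperm_eqmod.
apply: affperm_eq => c; rewrite !affpermM.
have [ca|ca] := boolP (c == a %[mod n])%Z.
  case/eqmodP: (ca) => k aE; have -> : c = a + (- k) * n by rewrite aE; ring.
  by rewrite !affpermD !transpL.
have [cb|cb] := boolP (c == b %[mod n])%Z.
  case/eqmodP: (cb) => k bE; have -> : c = b + (- k) * n by rewrite bE; ring.
  by rewrite !affpermD !transpR.
by rewrite !transpN // affperm_eqmod.
Qed.

Lemma transpKf a b : involutive (transp n a b).
Proof.
move=> c; have [ab|ab] := boolP (a == b %[mod n])%Z; first by rewrite transp1.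
have [ca|ca] := boolP (c == a %[mod n])%Z.
  case/eqmodP: (ca) => k aE; have -> : c = a + (- k) * n by rewrite aE; ring.
  by rewrite !affpermD transpL // transpR.
have [cb|cb] := boolP (c == b %[mod n])%Z.
  case/eqmodP: (cb) => k bE; have -> : c = b + (- k) * n by rewrite bE; ring.
  by rewrite !affpermD transpR // transpL.
by rewrite !transpN.
Qed.

Lemma transpK a b : (transp n a b * transp n a b = 1)%g.
Proof. by apply: affperm_eq => c; rewrite affpermM transpKf. Qed.

Lemma transpKM a b w : (transp n a b * (transp n a b * w) = w)%g.
Proof. by rewrite mulgA transpK mul1g. Qed.

Lemma transpC a b : transp n a b = transp n b a.
Proof.
have [ab|ab] := boolP (a == b %[mod n])%Z.
  by rewrite !transp1 // eq_sym.
have ba : ~~ (b == a %[mod n])%Z by rewrite eq_sym.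
apply: affperm_eq => c; rewrite !transpE //.
by case: ifP => // /eqP ->; rewrite (negPf ab).
Qed.

Lemma transp_shift a b k : transp n (a + k * n) (b + k * n) = transp n a b.
Proof.
have e c : (c + k * n == c %[mod n])%Z by exact: eqmodD.
have E c d : (c == d + k * n %[mod n])%Z = (c == d %[mod n])%Z.
  by have /eqP -> := e d.
apply: affperm_eq => c; rewrite /= /transp_fun !E.
have /eqP -> := e a.
have S (x y : int) : x + k * n - (y + k * n) = x - y by ring.
by rewrite !S.
Qed.

(** The position of the value [a] in [u]; all conditions are read off this
    function, because multiplication by a reflection on the left permutes its
    arguments. *)
Definition pos u a : int := (u^-1)%g a.

Lemma posD u a k : pos u (a + k * n) = pos u a + k * n.
Proof. exact: affpermD. Qed.

Lemma pos_inj u : injective (pos u). Proof. exact: affperm_inj. Qed.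

Lemma pos_eqmod u a b : (pos u a == pos u b %[mod n])%Z = (a == b %[mod n])%Z.
Proof. exact: affperm_eqmod. Qed.

Lemma posK u : cancel (pos u) u. Proof. exact: affpermVK. Qed.
Lemma Kpos u : cancel u (pos u). Proof. exact: affpermK. Qed.

Lemma pos1 a : pos 1%g a = a.
Proof. by rewrite /pos invg1. Qed.

Lemma pos_transp u a b c : pos (transp n a b * u)%g c = pos u (transp n a b c).
Proof.
rewrite -{1}[c](transpKf a b) -{1}[X in transp n a b X](posK u).
by rewrite -!affpermM Kpos.
Qed.

End Transpositions.

(** * Length, exchange and lifting *)

Section Length.
Variable n : nat.
Hypothesis n_gt1 : (1 < n)%N.
Implicit Types (a b c d i j k m : int) (u v w : affperm n) (s : seq 'Z_n).

Local Lemma n_gt0 : (0 < n)%N. Proof. exact: ltnW. Qed.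

Lemma Zint_eq i j : (i%:~R == j%:~R :> 'Z_n) = (i == j %[mod n])%Z.
Proof.
rewrite -subr_eq0 -rmorphB eqz_mod_dvd /=; move: (i - j) => k.
have E (m : nat) : (m%:R == 0 :> 'Z_n) = (n %| m)%N.
  by rewrite -val_eqE /= val_Zp_nat // /dvdn.
have -> : (n %| k)%Z = (n %| `|k|)%N by [].
rewrite -E; case: (intP k) => [|m|m]; rewrite ?mulr0z //.
by rewrite abszN rmorphN oppr_eq0.
Qed.

Lemma Zint_nat (z : 'Z_n) : ((z : nat)%:Z)%:~R = z.
Proof. exact: natr_Zp. Qed.

Definition srefl i : affperm n := transp n i (i + 1).

Lemma succ_neqmod i : ~~ (i == i + 1 %[mod n])%Z.
Proof.
rewrite eq_sym eqz_mod_dvd addrC addKr dvdz1 absz_nat.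
by rewrite gtn_eqF.
Qed.
#[local] Hint Resolve succ_neqmod : core.

Lemma srefl_mod i j : (i == j %[mod n])%Z -> srefl i = srefl j.
Proof.
by case/eqmodP => k ->; rewrite /srefl -(transp_shift n i _ k) addrAC.
Qed.

Lemma simple_reflE i : simple_refl (i%:~R : 'Z_n) = srefl i.
Proof. by apply: srefl_mod; rewrite -Zint_eq Zint_nat. Qed.

Lemma sreflL i : srefl i i = i + 1. Proof. exact: transpL. Qed.
Lemma sreflR i : srefl i (i + 1) = i. Proof. exact: transpR. Qed.
Lemma sreflK i : involutive (srefl i). Proof. exact: transpKf. Qed.
Lemma sreflKM i u : (srefl i * (srefl i * u) = u)%g. Proof. exact: transpKM. Qed.

Lemma pos_srefl i u c : pos (srefl i * u)%g c = pos u (srefl i c).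
Proof. exact: pos_transp. Qed.

Lemma sreflJ i a b u : ~~ (a == b %[mod n])%Z ->
  (srefl i * (transp n a b * u) = transp n (srefl i a) (srefl i b) * (srefl i * u))%g.
Proof. by move=> ab; rewrite mulgA transpJ // mulgA. Qed.

Lemma srefl_cases i c :
  [\/ (c == i %[mod n])%Z /\ srefl i c = c + 1,
      (c == i + 1 %[mod n])%Z /\ srefl i c = c - 1 |
      [/\ ~~ (c == i %[mod n])%Z, ~~ (c == i + 1 %[mod n])%Z & srefl i c = c]].
Proof.
have [ci|ci] := boolP (c == i %[mod n])%Z.
  by constructor 1; rewrite /srefl transpE // ci; split=> //; ring.
have [cj|cj] := boolP (c == i + 1 %[mod n])%Z; last first.
  by constructor 3; rewrite transpN.
by constructor 2; rewrite /srefl transpE // (negPf ci) cj; split=> //; ring.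
Qed.

(** Values move by at most one, so only neighbours exchanged with each other can end
    up in reverse order. *)
Lemma srefl_lt i a b : a < b -> ~~ (a == b %[mod n])%Z ->
  ~ ((a == i %[mod n])%Z /\ b = a + 1) -> srefl i a < srefl i b.
Proof.
move=> ab nab H.
have ia : (a == i %[mod n])%Z -> b <> a + 1 by move=> ai bE; apply: H.
case: (srefl_cases i a) => [[ai ->]|[ai ->]|[ai ai' ->]];
  case: (srefl_cases i b) => [[bi ->]|[bi ->]|[bi bi' ->]]; try by lia.
- have [e|] := eqVneq b (a + 1); first by case: (ia ai).
  have [e _|] := eqVneq b (a + 2%:Z); last by lia.
  move: bi; rewrite e; have -> : a + 2%:Z = a + 1 + 1 by ring.
  rewrite eqmodD2r => /eqP; rewrite -(eqP ai) => /eqP.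
  by rewrite eq_sym (negPf (succ_neqmod a)).
- have [e|] := eqVneq b (a + 1); last by lia.
  by move: bi ai; rewrite e eqmodD2r => ->.
Qed.

(** Exchanging two neighbours in the wrong order decreases this number, so that
    sorting terminates and every element is a product of simple reflections. *)
Definition displacement w : int := \sum_(i < n) (w i%:Z - i%:Z) ^+ 2.

Lemma displacement_ge0 w : 0 <= displacement w.
Proof. by apply: sumr_ge0 => i _; exact: sqr_ge0. Qed.

Lemma residue_eqmod i : (i == (i %% n)%Z %[mod n])%Z.
Proof. by rewrite modz_mod. Qed.

Lemma displacement_srefl w i :
  displacement (w * srefl i)%g = displacement w - 2%:Z * (w i - w (i + 1)).
Proof.
have dw v c k : v (c + k * n) - (c + k * n) = v c - c :> int.
  by rewrite (affpermD v); ring.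
rewrite /displacement.
transitivity (\sum_(j < n) (w j%:Z - srefl i j%:Z) ^+ 2).
  rewrite -(@sum_residues n (srefl i)
     (fun j => ((w * srefl i)%g j - j) ^+ 2)) //; first last.
  - move=> j; case/eqmodP: (residue_eqmod j) => k ->; by rewrite dw.
  - exact: is_affineP.
  by apply: eq_bigr => j _; rewrite affpermM sreflK.
suff <- : \sum_(j < n) (w j%:Z - j%:Z) ^+ 2 - \sum_(j < n) (w j%:Z - srefl i j%:Z) ^+ 2
          = 2%:Z * (w i - w (i + 1)) by rewrite subKr.
rewrite -sumrB.
under eq_bigr => j _.
  rewrite (_ : _ - _ = (j%:Z == i %[mod n])%Z%:R * (2%:Z * w i - 2%:Z * i - 1)
     + (j%:Z == i + 1 %[mod n])%Z%:R * (2%:Z * (i + 1) - 2%:Z * w (i + 1) - 1)); last first.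
  case: (srefl_cases i j%:Z) => [[ji ->]|[ji ->]|[/negPf-> /negPf-> ->]].
  - rewrite ji (eqP ji) (negPf (succ_neqmod i)).
    case/eqmodP: (ji) => k ->; rewrite (affpermD w) /=; ring.
  - rewrite ji (eqP ji) eq_sym (negPf (succ_neqmod i)).
    case/eqmodP: (ji) => k ->; rewrite (affpermD w) /=; ring.
  - by rewrite /=; ring.
  over.
rewrite big_split /= -!mulr_suml !sum_residue_eq ?n_gt0 //; ring.
Qed.

(** Without descents [w] grows by at least one at every step, and by exactly [n]
    over a period; so it is a translation, and the sum condition makes it trivial. *)
Lemma no_descent1 w : (forall i, w i < w (i + 1)) -> w = 1%g.
Proof.
move=> asc.
have le i (k : nat) : w i + k%:Z <= w (i + k%:Z).
  elim: k => [|k IH]; first by rewrite !addr0.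
  by have := asc (i + k%:Z); rewrite (_ : i + k.+1%:Z = i + k%:Z + 1); lia.
have step i : w (i + 1) = w i + 1.
  have := le (i + 1) n.-1; have := asc i; have := affpermD w i 1.
  have -> : i + 1 * n = i + 1 + n.-1 by have := n_gt0; lia.
  by have := n_gt0; lia.
have wE (k : nat) : w k%:Z = w 0 + k%:Z.
  elim: k => [|k IH]; first by rewrite addr0.
  by rewrite -addn1 PoszD step IH addrA.
have [_ wn] := is_affineP w; rewrite sum_window // => s0.
have w0 : w 0 = 0.
  move: s0; under eq_bigr => i _ do rewrite wE addrK.
  rewrite sumr_const card_ord => /eqP; rewrite mulrn_eq0.
  by have /lt0n_neq0/negPf-> := n_gt0 => /eqP.
apply: affperm_eq => i; rewrite affperm1.
case/eqmodP: (residue_eqmod i) => k /(congr1 (fun c => c - k * n)); rewrite addrK => <-.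
have [m ->] : exists m : nat, (i %% n)%Z = m by exists `|(i %% n)%Z|%N; rewrite gez0_abs // modz_ge0 // -lt0n n_gt0.
by rewrite -mulNr affpermD wE w0 add0r.
Qed.

Definition wprod s : affperm n := (\prod_(i <- s) simple_refl i)%g.

Lemma wprod_cons (z : 'Z_n) s : wprod (z :: s) = (simple_refl z * wprod s)%g.
Proof. exact: big_cons. Qed.

Lemma wprod_exists w : exists s, w = wprod s.
Proof.
have [m] := ubnP `|displacement w|%N; elim: m w => // m IH w ltm.
have [asc|] := pselect (forall i, w i < w (i + 1)).
  by exists [::]; rewrite (no_descent1 asc) /wprod big_nil.
move=> /existsNP[i /negP]; rewrite -leNgt le_eqVlt => /orP[/eqP/affperm_inj|lt].
  by move=> e; have := succ_neqmod i; rewrite -{1}e eqxx.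
have [|s ws] := IH (w * srefl i)%g.
  by have := displacement_ge0 (w * srefl i)%g; rewrite displacement_srefl; lia.
exists (rcons s i%:~R); rewrite /wprod -cats1 big_cat big_seq1 -/(wprod s) -ws /=.
by rewrite simple_reflE -mulgA transpK mulg1.
Qed.

Local Notation len := (@aff_length n).

Lemma len_is_length w : is_length w (len w).
Proof.
rewrite /aff_length; case: xgetP => // /(_ _) H; exfalso.
have [s0 ws0] := wprod_exists w.
have ex : exists k : nat, `[< exists2 s, size s = k & w = wprod s >].
  by exists (size s0); apply/asboolP; exists s0.
case: (ex_minnP ex) => k /asboolP[s sk ws] kmin.
apply: (H k); split; first by exists s.
by move=> s' ws'; apply: kmin; apply/asboolP; exists s'.
Qed.

Lemma len_wprod_le s : (len (wprod s) <= size s)%N.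
Proof. by have [_] := len_is_length (wprod s); apply. Qed.

Lemma len_word w : exists2 s, size s = len w & w = wprod s.
Proof. by have [] := len_is_length w. Qed.

Lemma len1 : len 1%g = 0%N.
Proof. by apply/eqP; rewrite -leqn0; have := len_wprod_le [::]; rewrite /wprod big_nil. Qed.

(** Strong exchange: if the values [a < b] occur in the wrong order, the
    reflection exchanging them deletes the letter of the word at which their
    order was reversed. *)
Lemma exchange s a b : a < b -> ~~ (a == b %[mod n])%Z ->
    pos (wprod s) b < pos (wprod s) a ->
  exists2 s', size s = (size s').+1 & (transp n a b * wprod s)%g = wprod s'.
Proof.
elim: s a b => [|i s IH] a b ab nab.
  by rewrite /wprod big_nil !pos1 => /lt_trans/(_ ab); rewrite ltxx.
rewrite wprod_cons -[i]Zint_nat; move: (i : nat)%:Z => {}i.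
rewrite simple_reflE !pos_srefl => inv.
have [[ai bE]|H] := pselect ((a == i %[mod n])%Z /\ b = a + 1).
  exists s; first by [].
  by rewrite bE -/(srefl a) (srefl_mod ai) sreflKM.
have nab' : ~~ (srefl i a == srefl i b %[mod n])%Z by rewrite affperm_eqmod.
have [s' ss E] := IH _ _ (srefl_lt ab nab H) nab' inv.
exists (i%:~R :: s'); first by rewrite /= ss.
by rewrite wprod_cons simple_reflE -E sreflJ // !sreflK.
Qed.

Lemma len_transp_lt u a b : a < b -> ~~ (a == b %[mod n])%Z ->
  pos u b < pos u a -> (len (transp n a b * u)%g < len u)%N.
Proof.
move=> ab nab; have [s <- ->] := len_word u => inv.
by have [s' -> ->] := exchange ab nab inv; rewrite ltnS len_wprod_le.
Qed.

Lemma len_transp_gt u a b : a < b -> ~~ (a == b %[mod n])%Z ->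
  pos u a < pos u b -> (len u < len (transp n a b * u)%g)%N.
Proof.
move=> ab nab asc; rewrite -{1}[u](transpKM a b) len_transp_lt //.
by rewrite !pos_transp transpR // transpL.
Qed.

(** The length criterion: [exchange] gives one direction, and its application to the
    reflected element gives the other. *)
Lemma len_transpE u a b : a < b -> ~~ (a == b %[mod n])%Z ->
  (len (transp n a b * u)%g < len u)%N = (pos u b < pos u a).
Proof.
move=> ab nab; apply/idP/idP => [lt|]; last exact: len_transp_lt.
rewrite ltNge le_eqVlt; apply/negP => /orP[/eqP/pos_inj e|].
  by move: ab; rewrite e ltxx.
by move/(len_transp_gt ab nab)/(ltn_trans lt); rewrite ltnn.
Qed.

Lemma len_srefl_le u i : (len (srefl i * u)%g <= (len u).+1)%N.
Proof.
have [s <- ->] := len_word u.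
by rewrite -simple_reflE -wprod_cons (leq_trans (len_wprod_le _)).
Qed.

Lemma len_srefl u i : len (srefl i * u)%g =
  if pos u i < pos u (i + 1) then (len u).+1 else (len u).-1.
Proof.
have le := len_srefl_le u i; have := len_srefl_le (srefl i * u)%g i.
rewrite sreflKM => ge; have ii : i < i + 1 by lia.
case: ifP => asc; first by have := len_transp_gt ii (succ_neqmod i) asc; rewrite -/(srefl i); lia.
have : pos u (i + 1) < pos u i.
  rewrite lt_neqAle leNgt asc andbT; apply/eqP => /pos_inj e.
  by move: ii; rewrite e ltxx.
by move/(len_transp_lt ii (succ_neqmod i)); rewrite -/(srefl i); lia.
Qed.

Lemma pos_ltgt u i : (pos u i < pos u (i + 1)) = ~~ (pos u (i + 1) < pos u i).
Proof.
rewrite -leNgt le_eqVlt; case: eqP => // /pos_inj; lia.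
Qed.

Lemma len_srefl_asc u i : pos u i < pos u (i + 1) -> len (srefl i * u)%g = (len u).+1.
Proof. by rewrite len_srefl => ->. Qed.

Lemma len_srefl_desc u i : pos u (i + 1) < pos u i -> len u = (len (srefl i * u)%g).+1.
Proof.
move=> desc; rewrite -{1}[u](sreflKM i) len_srefl !pos_srefl sreflL sreflR.
by rewrite desc.
Qed.

(** Lifting. Unless it exchanges [a] and [b], the reflection [s] at [i] keeps them in
    order, so that [s w] is shorter than [s u]; but [s w] is longer than [w], while
    [s u] is only as long as [w]. *)
Lemma lifting w a b i : a < b -> ~~ (a == b %[mod n])%Z ->
    len (transp n a b * w)%g = (len w).+1 ->
    pos w i < pos w (i + 1) ->
    pos (transp n a b * w)%g (i + 1) < pos (transp n a b * w)%g i ->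
  (a == i %[mod n])%Z /\ b = a + 1.
Proof.
set u := (_ * w)%g => ab nab lu asc desc.
have [//|H] := pselect ((a == i %[mod n])%Z /\ b = a + 1).
exfalso; have lt := srefl_lt ab nab H.
have nab' : ~~ (srefl i a == srefl i b %[mod n])%Z by rewrite affperm_eqmod.
have wu : w = (transp n a b * u)%g by rewrite transpKM.
have lsu := len_srefl_desc desc; have lsw := len_srefl_asc asc.
have inv : pos (srefl i * u)%g (srefl i b) < pos (srefl i * u)%g (srefl i a).
  by rewrite !pos_srefl !sreflK -len_transpE // -wu lu.
by have := len_transp_lt lt nab' inv; rewrite -sreflJ // -wu; lia.
Qed.

End Length.

(** * Covers and intermediate values *)

Section Between.
Variable n : nat.
Hypothesis n_gt1 : (1 < n)%N.
Implicit Types (a b c d i j k m q : int) (u v w : affperm n).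
Local Notation len := (@aff_length n).

Lemma eqmod_ltD a c : a < c -> (c == a %[mod n])%Z -> exists2 k : int, c = a + k * n & 0 < k.
Proof.
move=> ac; rewrite eq_sym => /eqmodP[k cE]; exists k => //.
by move: ac; rewrite cE ltrDl pmulr_lgt0 // ltz_nat ltnW.
Qed.

(** When the intermediate value [c] has a residue of its own, the transposition of
    [a] and [m] is a product of three reflections that each increase the length. *)
Lemma len_between_generic w a c m : a < c -> c < m ->
    ~~ (a == m %[mod n])%Z -> ~~ (c == a %[mod n])%Z -> ~~ (c == m %[mod n])%Z ->
    pos w a < pos w c -> pos w c < pos w m ->
  ((len w).+1 < len (transp n a m * w)%g)%N.
Proof.
move=> ac cm nam nca ncm Pac Pcm.
have am := lt_trans ac cm; have nac : ~~ (a == c %[mod n])%Z by rewrite eq_sym.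
have nma : ~~ (m == a %[mod n])%Z by rewrite eq_sym.
have nmc : ~~ (m == c %[mod n])%Z by rewrite eq_sym.
have l1 := len_transp_gt n_gt1 ac nac Pac.
have l2 : (len (transp n a c * w)%g < len (transp n a m * (transp n a c * w))%g)%N.
  by apply: len_transp_gt => //; rewrite !pos_transp transpL // transpN.
have l3 : (len (transp n a m * (transp n a c * w))%g
           < len (transp n c m * (transp n a m * (transp n a c * w)))%g)%N.
  apply: len_transp_gt => //; rewrite !pos_transp.
  by rewrite [transp n a m c]transpN // [transp n a m m]transpR // transpR // transpL.
suff e : (transp n c m * (transp n a m * (transp n a c * w)) = transp n a m * w)%g.
  by rewrite -e; lia.
have := transpJ (transp n a m) nac; rewrite transpL // transpN // => J.
by rewrite [transp n c m]transpC !mulgA -J -!mulgA transpKM.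
Qed.

(** Two values that are more than [n] apart, at positions more than [n] apart:
    the cover would have to skip elements of the infinite dihedral group that
    permutes their two residue classes. *)
Lemma len_between_far w a m : ~~ (a == m %[mod n])%Z ->
    a + n < m -> pos w a + n < pos w m ->
  ((len w).+1 < len (transp n a m * w)%g)%N.
Proof.
move=> nam anm Panm; have n0 : 0 < n%:Z by rewrite ltz_nat ltnW.
(* The three reflections exchange [a] with the copies [m - n], [m + (q - 1) n] and
   [m + q n] of [m]; the choice of [q] makes each of them an ascent. *)
pose q := ((pos w m - pos w a) %/ n)%Z.
have qE := divz_eq (pos w m - pos w a) n.
have r0 := modz_ge0 (pos w m - pos w a) (lt0r_neq0 n0).
have rn := ltz_pmod (pos w m - pos w a) n0.
have r_neq0 : ((pos w m - pos w a) %% n)%Z != 0.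
  apply: contra nam => /eqP r0'; rewrite -(pos_eqmod w) eq_sym eqz_mod_dvd.
  exact/dvdz_mod0P.
rewrite -/q in qE; move: (modz _ _) => r in qE r0 rn r_neq0.
have q0 : 0 < q by nia.
have nam' k : ~~ (a == m + k * n %[mod n])%Z by rewrite (eqP (eqmodD n m k)).
have trL k : transp n a (m + k * n) a = m + k * n by rewrite transpL.
have trR k c : transp n a (m + k * n) (m + c * n) = a + (c - k) * n.
  have -> : m + c * n = m + k * n + (c - k) * n by ring.
  by rewrite affpermD transpR.
have trA k c : transp n a (m + k * n) (a + c * n) = m + (k + c) * n.
  by rewrite affpermD transpL //; ring.
pose x1 := (transp n a (m + (- (1 : int)) * n) * w)%g.
pose x2 := (transp n a (m + (q - 1) * n) * x1)%g.
have l1 : (len w < len x1)%N.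
  apply: len_transp_gt => //; first by lia.
  by rewrite posD; lia.
have l2 : (len x1 < len x2)%N.
  apply: len_transp_gt => //; first by nia.
  by rewrite !pos_transp trL trR !posD; nia.
have l3 : (len x2 < len (transp n a (m + q * n) * x2)%g)%N.
  apply: len_transp_gt => //; first by nia.
  by rewrite !pos_transp trL !trR trA !posD; nia.
suff e : (transp n a (m + q * n) * x2 = transp n a m * w)%g by rewrite -e; lia.
rewrite /x2 /x1 !mulgA; congr (_ * w)%g; apply: affperm_eq => c.
rewrite !affpermM.
have [ca|ca] := boolP (c == a %[mod n])%Z.
  case/eqmodP: (ca) => k aE; have -> : c = a + (- k) * n by rewrite aE; ring.
  by have := trA 0%:Z (- k); rewrite mul0r addr0 => ->; rewrite trA trR trA; congr (_ + _ * _); ring.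
have [cm|cm] := boolP (c == m %[mod n])%Z.
  case/eqmodP: (cm) => k mE; have -> : c = m + (- k) * n by rewrite mE; ring.
  by have := trR 0%:Z (- k); rewrite mul0r addr0 => ->; rewrite trR trA trR; congr (_ + _ * _); ring.
by rewrite !transpN // (eqP (eqmodD n m _)).
Qed.

(** If [c] has the residue of [a] or of [m], periodicity makes [a] and [m] more than
    [n] apart both in value and in position; otherwise the case is generic. *)
Lemma no_between w a c m : ~~ (a == m %[mod n])%Z ->
    len (transp n a m * w)%g = (len w).+1 ->
    a < c -> c < m -> pos w a < pos w c -> pos w c < pos w m -> False.
Proof.
move=> nam lw ac cm Pac Pcm.
have n0 : 0 < n%:Z by rewrite ltz_nat ltnW.
suff : ((len w).+1 < len (transp n a m * w)%g)%N by rewrite lw ltnn.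
have [ca|nca] := boolP (c == a %[mod n])%Z.
  have [k cE k0] := eqmod_ltD ac ca; move: cm Pcm; rewrite cE posD => cm Pcm.
  by apply: len_between_far => //; nia.
have [cm'|ncm] := boolP (c == m %[mod n])%Z; last exact: (len_between_generic ac cm).
have [|k mE k0] := eqmod_ltD cm; first by rewrite eq_sym.
by apply: len_between_far => //; rewrite mE ?posD; nia.
Qed.

End Between.
(** * The ring of additive endomorphisms *)

(** Additive maps form a ring under composition, in which the identities between
    operators can be computed. *)
Record endo (V : zmodType) := Endo {
  endo_fun :> V -> V;
  endoD : forall f g, endo_fun (f + g) = endo_fun f + endo_fun g }.

Section EndoRing.
Variable V : zmodType.
Implicit Types A B C : endo V.

HB.instance Definition _ := gen_eqMixin (endo V).
HB.instance Definition _ := gen_choiceMixin (endo V).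

Lemma endo_eq A B : (forall f, A f = B f) -> A = B.
Proof.
case: A B => [a aD] [b bD] /= /funext ab.
by case: _ / ab in bD *; congr Endo; exact: Prop_irrelevance.
Qed.

Fact endo_zero_subproof (f g : V) : 0 = 0 + 0 :> V. Proof. by rewrite addr0. Qed.
Definition endo_zero := Endo endo_zero_subproof.

Fact endo_opp_subproof A f g : - A (f + g) = - A f + - A g.
Proof. by rewrite endoD opprD. Qed.
Definition endo_opp A := Endo (endo_opp_subproof A).

Fact endo_add_subproof A B f g : A (f + g) + B (f + g) = A f + B f + (A g + B g).
Proof. by rewrite !endoD addrACA. Qed.
Definition endo_add A B := Endo (endo_add_subproof A B).

Definition endo_one := @Endo V id (fun f g => erefl).

Fact endo_mul_subproof A B f g : A (B (f + g)) = A (B f) + A (B g).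
Proof. by rewrite !endoD. Qed.
Definition endo_mul A B := Endo (endo_mul_subproof A B).

Fact endo_addA : associative endo_add.
Proof. by move=> A B C; apply: endo_eq => f; rewrite /= addrA. Qed.
Fact endo_addC : commutative endo_add.
Proof. by move=> A B; apply: endo_eq => f; rewrite /= addrC. Qed.
Fact endo_add0 : left_id endo_zero endo_add.
Proof. by move=> A; apply: endo_eq => f; rewrite /= add0r. Qed.
Fact endo_addN : left_inverse endo_zero endo_opp endo_add.
Proof. by move=> A; apply: endo_eq => f; rewrite /= addNr. Qed.

HB.instance Definition _ :=
  GRing.isZmodule.Build (endo V) endo_addA endo_addC endo_add0 endo_addN.

Fact endo_mulA : associative endo_mul.
Proof. by move=> A B C; apply: endo_eq. Qed.
Fact endo_mul1 : left_id endo_one endo_mul.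
Proof. by move=> A; apply: endo_eq. Qed.
Fact endo_mulr1 : right_id endo_one endo_mul.
Proof. by move=> A; apply: endo_eq. Qed.
Fact endo_mulDl : left_distributive endo_mul endo_add.
Proof. by move=> A B C; apply: endo_eq. Qed.
Fact endo_mulDr : right_distributive endo_mul endo_add.
Proof. by move=> A B C; apply: endo_eq => f; rewrite /= endoD. Qed.

HB.instance Definition _ := GRing.Zmodule_isPzRing.Build (endo V)
  endo_mulA endo_mul1 endo_mulr1 endo_mulDl endo_mulDr.

Lemma endoDE A B f : (A + B) f = A f + B f. Proof. by []. Qed.
Lemma endoBE A B f : (A - B) f = A f - B f. Proof. by []. Qed.
Lemma endoME A B f : (A * B) f = A (B f). Proof. by []. Qed.
Lemma endo1E f : (1 : endo V) f = f. Proof. by []. Qed.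

Lemma endo_sumE I (r : seq I) (P : pred I) (F : I -> endo V) f :
  (\sum_(i <- r | P i) F i) f = \sum_(i <- r | P i) F i f.
Proof. by elim/big_rec2: _ => // i A x _ <-; rewrite endoDE. Qed.

End EndoRing.

(** * Weak steps against strong covers *)

Section Covers.
Variable n : nat.
Hypothesis n_gt1 : (1 < n)%N.
Variable l : int.
Implicit Types (a b c d i j k m p q : int) (u v w : affperm n).
Local Notation len := (@aff_length n).
Local Notation tr := (transp n).
Local Notation sr := (@srefl n).
Let n0 : 0 < n%:Z. Proof. by rewrite ltz_nat ltnW. Qed.

(** Periodicity bounds the displacements by those of one window. *)
Lemma pos_bounded u : exists N : nat, forall a, a - N%:Z <= pos u a <= a + N%:Z.
Proof.
pose N := (\sum_(i < n) `|pos u i%:Z - i%:Z|)%N; exists N => a.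
case/eqmodP: (residue_eqmod n a) => k aE.
have -> : pos u a = a + (pos u (a %% n)%Z - (a %% n)%Z).
  by rewrite aE posD; zlia.
have r0 := modz_ge0 a (lt0r_neq0 n0); have rn := ltz_pmod a n0.
move: r0 rn; case: (modz a n) => // r _; rewrite ltz_nat => rn.
have : (`|pos u r - r| <= N)%N.
  by rewrite /N (bigD1 (Ordinal rn)) //= leq_addr.
by zlia.
Qed.

(** The values [a] exchanged with the marking [m] by the last cover of a strip
    ending at [u]. *)
Definition covset u m : set int :=
  [set a | [/\ a < m, l < pos u a, pos u m <= l & len u = (len (tr a m * u)%g).+1]].

Lemma covset_neqmod u m a : covset u m a -> ~~ (a == m %[mod n])%Z.
Proof.
by case=> _ _ _; apply: contraPN => am; rewrite transp1 // mul1g => /n_Sn.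
Qed.

Lemma covsetV u m a : covset u m a ->
  len (tr a m * (tr a m * u))%g = (len (tr a m * u)%g).+1.
Proof. by case=> _ _ _ lu; rewrite transpKM. Qed.

Lemma finite_int_segment a b : finite_set [set c : int | a <= c < b].
Proof.
apply: (@sub_finite_set _ _ ((fun k : nat => a + k%:Z) @` `I_`|b - a|%N)).
  by move=> c /= ?; exists `|c - a|%N => /=; zlia.
exact/finite_image/finite_II.
Qed.

Lemma finite_covset u m : finite_set (covset u m).
Proof.
have [N uN] := pos_bounded u.
apply: sub_finite_set (finite_int_segment (l - N%:Z) m) => a [am la _ _] /=.
by have := uN a; zlia.
Qed.

(** The covers other than the simple reflection at [i] itself, which
    conjugation by it turns into the reverse exchange of the same two values. *)
Definition covset' i u m : set int :=
  [set a | covset u m a /\ ~ ((a == i %[mod n])%Z /\ m = a + 1)].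

(** After the weak step at [i], the conjugate of a cover goes down from [u] by at
    least one, and its lower end goes up by at most one along [i]; the lengths leave
    only a cover of [u] with an ascent at [i] below it. *)
Lemma covset'_srefl i u m a : pos u i < pos u (i + 1) ->
    covset' i (sr i * u)%g m a ->
  covset' i u (sr i m) (sr i a) /\
  pos (tr (sr i a) (sr i m) * u)%g i < pos (tr (sr i a) (sr i m) * u)%g (i + 1).
Proof.
move=> asc [ca nex]; have nam := covset_neqmod ca; case: ca => am la lm lsu.
have lt := srefl_lt n_gt1 am nam nex.
have nam' : ~~ (sr i a == sr i m %[mod n])%Z by rewrite affperm_eqmod.
rewrite !pos_srefl in la lm.
set w := (tr _ _ * u)%g.
have lw : (len w < len u)%N by apply: len_transp_lt => //; apply: le_lt_trans la.
have lsw : len (sr i * w)%g = len u.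
  by rewrite /w sreflJ // !sreflK //; have := len_srefl_asc n_gt1 asc; zlia.
have lwu : len u = (len w).+1.
  by have := len_srefl_le n_gt1 w i; zlia.
split; last first.
  by rewrite pos_ltgt //; apply/negP => /(len_srefl_desc n_gt1); zlia.
split; first by split.
move=> [ai mE]; case: (srefl_cases n_gt1 i a) => [[ai' E]|[ai' E]|[ai' _ E]].
- by move: ai; rewrite E -(eqP ai') eq_sym (negPf (succ_neqmod n_gt1 a)).
- rewrite E in ai mE; case: (srefl_cases n_gt1 i m) => [[_ E']|[mi _]|[_ mi E']].
  + by zlia.
  + by move: nam; rewrite (eqP ai') (eqP mi) eqxx.
  + by move: mi am; rewrite -E' mE; zlia.
- by rewrite E (negPf ai') in ai.
Qed.

(** The converse: by lifting, an ascent at [i] below the cover gives an ascent at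
    [i] above it. *)
Lemma covset'_sreflV i u m a :
    covset' i u (sr i m) (sr i a) ->
    pos (tr (sr i a) (sr i m) * u)%g i < pos (tr (sr i a) (sr i m) * u)%g (i + 1) ->
  pos u i < pos u (i + 1) /\ covset' i (sr i * u)%g m a.
Proof.
move=> [ca nex]; have nam' := covset_neqmod ca; case: ca => sam la lm lwu.
have nam : ~~ (a == m %[mod n])%Z by rewrite -(affperm_eqmod (sr i)).
have := srefl_lt n_gt1 sam nam' nex; rewrite !sreflK // => am.
set w := (tr _ _ * u)%g in lwu * => wasc.
have lsw := len_srefl_asc n_gt1 wasc.
have uE : u = (tr (sr i a) (sr i m) * w)%g by rewrite transpKM.
have asc : pos u i < pos u (i + 1).
  rewrite pos_ltgt //; apply/negP => desc; apply: nex.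
  by apply: (@lifting _ n_gt1 w) => //; rewrite -uE.
split=> //; split; last first.
  move=> [ai mE]; move: sam; rewrite mE.
  have e : sr i = sr a by apply: srefl_mod; rewrite eq_sym.
  by rewrite e sreflL // sreflR //; zlia.
split=> //; rewrite ?pos_srefl //.
by rewrite (len_srefl_asc n_gt1 asc) -[a](@sreflK n i) -[m](@sreflK n i)
  -sreflJ // -/w lsw lwu.
Qed.

Lemma reindex_fsbig_can (I J : choiceType) (h : I -> J) (h' : J -> I)
    (P : set I) (Q : set J) (F : J -> int) :
  (forall x, P x -> Q (h x)) -> (forall y, Q y -> P (h' y)) ->
  (forall x, P x -> h' (h x) = x) -> (forall y, Q y -> h (h' y) = y) ->
  \sum_(y \in Q) F y = \sum_(x \in P) F (h x).
Proof.
move=> PQ QP hK h'K; apply: reindex_fsbig; split=> //.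
  by move=> x y /set_mem Px /set_mem Py e; rewrite -(hK x) // e hK.
by move=> y Qy; exists (h' y); [exact: QP|exact: h'K].
Qed.

(** Steps act on functions by pull-back: a function of the end of a weak step, or of
    the start of a strong cover, becomes a function of its other end. *)
Definition weak_up i (g : affperm n -> int) u : int :=
  if pos u i < pos u (i + 1) then g (sr i * u)%g else 0.

Definition strong_down m (g : affperm n -> int) u : int :=
  \sum_(a \in covset u m) g (tr a m * u)%g.

(** Conjugation by the simple reflection at [i] matches the covers seen before
    and after a weak step at [i]; only the reflection itself escapes. *)
Lemma sum_covset'_srefl i u m (g : affperm n -> int) :
  (if pos u i < pos u (i + 1)
   then \sum_(a \in covset' i (sr i * u)%g m) g (tr a m * (sr i * u))%g else 0) =
  \sum_(a \in covset' i u (sr i m)) weak_up i g (tr a (sr i m) * u)%g.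
Proof.
have sK := @sreflK n i.
case: ifP => [asc|nasc]; last first.
  rewrite fsbig1 // => a; rewrite -(sK a) => ca; rewrite /weak_up.
  by case: ifP => // /(covset'_sreflV ca)[]; rewrite nasc.
pose Q : set int := [set a | covset' i u (sr i m) a /\
  pos (tr a (sr i m) * u)%g i < pos (tr a (sr i m) * u)%g (i + 1)].
rewrite -(fsbig_widen Q (covset' i u (sr i m))); first last.
- move=> a [ca nQ]; rewrite /weak_up /=; case: ifP => // asc'.
  by case: nQ.
- by move=> a [].
rewrite [RHS](@reindex_fsbig_can _ _ (sr i) (sr i) (covset' i (sr i * u)%g m)) //.
- apply: eq_fsbigr => a /set_mem ca; rewrite /weak_up.
  have [_ ->] := covset'_srefl asc ca.
  by rewrite sreflJ ?sK // affperm_eqmod; case: ca => /covset_neqmod.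
- by move=> a ca; apply: covset'_srefl.
- move=> a; rewrite -{1}(sK a) => -[ca asc'].
  by have [] := covset'_sreflV ca asc'.
Qed.

Lemma covset'_id i u m : ~~ (m == i + 1 %[mod n])%Z -> covset' i u m = covset u m.
Proof.
move=> nm; apply/seteqP; split=> a; first by case.
move=> ca; split=> // -[/eqmodP[k ai] mE]; move/negP: nm; apply.
by apply/eqmodP; exists k; rewrite mE ai; ring.
Qed.

Lemma sum_covset_succ p u (F : int -> int) :
  \sum_(a \in covset u (p + 1)) F a = \sum_(a \in covset' p u (p + 1)) F a
  + (if pos u (p + 1) <= l < pos u p then F p else 0).
Proof.
have c'E : covset' p u (p + 1) = covset u (p + 1) `\ p.
  apply/seteqP; split=> a [ca H]; split=> //.
    by move=> ap; apply: H; rewrite ap.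
  by move=> [_ /addIr ap]; apply: H.
case: ifP => [/andP[lm la]|nc].
  have cp : covset u (p + 1) p.
    split=> //; first by zlia.
    rewrite -/(sr p); apply: len_srefl_desc => //.
    exact: le_lt_trans lm la.
  rewrite (fsbigD1 p _ _ (finite_covset u (p + 1)) cp) -c'E; exact: addrC.
rewrite addr0 c'E not_setD1 // => -[_ la lm _].
by rewrite la lm in nc.
Qed.

Lemma weak_up_strong_down i m f u :
    ~~ (m == i %[mod n])%Z -> ~~ (m == i + 1 %[mod n])%Z ->
  weak_up i (strong_down m f) u = strong_down m (weak_up i f) u.
Proof.
move=> mi mi'; rewrite {1}/weak_up /strong_down.
by have := sum_covset'_srefl i u m f; rewrite transpN // !covset'_id.
Qed.

Lemma self_neqmod p : ~~ (p == p + 1 %[mod n])%Z.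
Proof. exact: succ_neqmod. Qed.

Lemma weak_up_strong_down_succ p f u :
  weak_up p (strong_down (p + 1) f) u = strong_down p (weak_up p f) u
    + (if pos u p <= l < pos u (p + 1) then f u else 0).
Proof.
rewrite {1}/weak_up /strong_down sum_covset_succ.
have := sum_covset'_srefl p u (p + 1) f; rewrite sreflR // (@covset'_id p u p) ?self_neqmod // => <-.
rewrite -/(sr p) sreflKM // !pos_srefl sreflL // sreflR //.
case: ifP => // nasc; rewrite add0r; case: ifP => // /andP[lm la].
by rewrite (le_lt_trans lm la) in nasc.
Qed.

Lemma strong_down_succ_weak_up p f u :
  strong_down (p + 1) (weak_up p f) u = weak_up p (strong_down p f) u
    + (if pos u (p + 1) <= l < pos u p then f u else 0).
Proof.
rewrite {2}/weak_up /strong_down sum_covset_succ.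
have := sum_covset'_srefl p u p f; rewrite sreflL // => <-.
rewrite (@covset'_id p _ p) ?self_neqmod //; congr (_ + _).
case: ifP => // /andP[lm la].
by rewrite /weak_up -/(sr p) !pos_srefl sreflL // sreflR // (le_lt_trans lm la) sreflKM.
Qed.

(** Two successive covers with the adjacent markings [p + 1] and [p] that leave
    an ascent at [p] must start with the reflection at [p]: otherwise lifting
    orders the values involved, and then one of the two covers jumps over an
    intermediate value. *)
Lemma no_double_cover p u a a' : covset u (p + 1) a -> a <> p ->
    covset (tr a (p + 1) * u)%g p a' ->
    pos (tr a' p * (tr a (p + 1) * u))%g p <
      pos (tr a' p * (tr a (p + 1) * u))%g (p + 1) -> False.
Proof.
set w1 := (tr a _ * u)%g => ca ap ca' asc.
have na := covset_neqmod ca; have na' := covset_neqmod ca'.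
have len_u := covsetV ca; have len_w1 := covsetV ca'.
rewrite -/w1 in len_u; set w2 := (tr a' p * w1)%g in asc len_w1.
have [ap1 la lp1 _] := ca; have [a'p la' lp _] := ca'.
have a_lt_p : a < p by move: ap => /eqP; zlia.
have w1p1 : pos w1 (p + 1) = pos u a by rewrite pos_transp transpR.
have w1a : pos w1 a = pos u (p + 1) by rewrite pos_transp transpL.
have w2p : pos w2 p = pos w1 a' by rewrite pos_transp transpR.
have w2a' : pos w2 a' = pos w1 p by rewrite pos_transp transpL.
have u_w1 : (tr a (p + 1) * w1 = u)%g by rewrite transpKM.
have w1_w2 : (tr a' p * w2 = w1)%g by rewrite transpKM.
have uasc : pos u p < pos u (p + 1).
  rewrite pos_ltgt //; apply/negP => desc.
  have w1asc : pos w1 p < pos w1 (p + 1) by rewrite w1p1; apply: le_lt_trans la.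
  have [|_ /addIr ap'] := @lifting _ n_gt1 w1 a (p + 1) p ap1 na len_u w1asc.
    by rewrite u_w1.
  by apply: ap; rewrite ap'.
have nap : ~~ (a == p %[mod n])%Z.
  apply/negP; rewrite eq_sym => pa.
  have [k pE k0] := eqmod_ltD n_gt1 a_lt_p pa.
  by move: uasc; rewrite {1}pE posD; znia.
have w1p : pos w1 p = pos u p.
  by rewrite pos_transp transpN ?self_neqmod // eq_sym.
have npp1 : ~~ (p == p + 1 %[mod n])%Z by exact: self_neqmod.
have [aa'|a'a|aa'] := ltgtP a a'.
- apply: (@no_between _ n_gt1 w1 a a' (p + 1)) => //.
  + by apply: lt_trans a'p _; zlia.
  + by rewrite w1a; apply: le_lt_trans la'.
  + rewrite -w2p; have [a'p1|na'p1] := boolP (a' == p + 1 %[mod n])%Z.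
      have [||k pE k0] := @eqmod_ltD _ n_gt1 a' (p + 1); first by zlia.
        by rewrite eq_sym.
      by rewrite pE posD w2p; znia.
    by apply: lt_le_trans asc _; rewrite pos_transp transpN // eq_sym.
- have naa' : ~~ (a == a' %[mod n])%Z.
    apply/negP => aa'; have [k aE k0] := eqmod_ltD n_gt1 a'a aa'.
    move: lp1; rewrite -w1a aE posD; znia.
  apply: (@no_between _ n_gt1 w2 a' a p) => //.
  + by rewrite w2a' w1p [pos w2 a]pos_transp transpN // w1a.
  + by rewrite w2p [pos w2 a]pos_transp transpN // w1a; apply: le_lt_trans la'.
- by move: la'; rewrite -aa' w1a ltNge lp1.
Qed.

(** By [no_double_cover] the first cover on the left is the reflection at [p], and
    moving the weak step past the second cover cancels it. On the right, lifting
    shows that every cover other than this reflection keeps [p] to the right of [l]. *)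
Lemma strong_down2_weak_up p f u :
  strong_down (p + 1) (strong_down p (weak_up p f)) u =
  strong_down (p + 1)
    (fun w => if (l < pos w p) && (l < pos w (p + 1)) then f w else 0) u.
Proof.
rewrite {1 3}/strong_down !sum_covset_succ.
rewrite fsbig1 ?add0r; last first.
  move=> a [ca nap]; rewrite /strong_down fsbig1 // => a' ca'; rewrite /weak_up.
  case: ifP => // /(no_double_cover ca _ ca')[] // ap.
  by apply: nap; rewrite ap.
rewrite -/(sr p) pos_srefl sreflL // pos_srefl sreflR //.
have -> : (if pos u (p + 1) <= l < pos u p
   then if (l < pos u (p + 1)) && (l < pos u p) then f (sr p * u)%g else 0 else 0) = 0.
  by case: ifP => // /andP[lm _]; rewrite ltNge lm.
rewrite addr0; case: ifP => [/andP[lm la]|nc].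
  rewrite /strong_down.
  have := sum_covset'_srefl p (sr p * u)%g (p + 1) f.
  rewrite sreflR // sreflKM // !pos_srefl sreflL // sreflR // (le_lt_trans lm la).
  rewrite (@covset'_id p _ p) ?self_neqmod // => <-.
  apply: eq_fsbigr => a /set_mem [ca nap].
  case: ca => ap1 la' lp1 lu; have na : ~~ (a == p + 1 %[mod n])%Z.
    by apply: (@covset_neqmod u).
  have -> : l < pos (tr a (p + 1) * u)%g (p + 1) by rewrite pos_transp transpR.
  rewrite andbT pos_transp; have [pa|npa] := boolP (p == a %[mod n])%Z; last first.
    by rewrite transpN ?la // self_neqmod.
  case: ifP => // /negbT; rewrite -leNgt -pos_transp => w1p.
  have [|||_ /addIr] := @lifting _ n_gt1 (tr a (p + 1) * u)%g a (p + 1) p ap1 na.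
  + by rewrite transpKM.
  + by rewrite [pos _ (p + 1)]pos_transp transpR //; apply: le_lt_trans la'.
  + by rewrite transpKM; apply: le_lt_trans la.
  + by move=> ap; case: nap; rewrite -ap.
apply/esym; apply: fsbig1 => a [[ap1 la' lp1 lu] nap]; case: ifP => // /andP[].
have na : ~~ (a == p + 1 %[mod n])%Z by apply: (@covset_neqmod u).
move: nc; rewrite lp1 /= => /negbT; rewrite -leNgt => lp.
rewrite pos_transp; have [pa|npa] := boolP (p == a %[mod n])%Z; last first.
  by rewrite transpN ?self_neqmod // ltNge lp.
have [|k pE k0] := eqmod_ltD n_gt1 _ pa.
  by move: ap1; rewrite lt_neqAle; case: (eqVneq a p) nap => [->|]; [case|zlia].
by move: lp; rewrite pE posD; znia.
Qed.

End Covers.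

(** * The graded operators and the exchange relation *)

Section Operators.
Variable n : nat.
Hypothesis n_gt1 : (1 < n)%N.
Variable l : int.
Implicit Types (a b c i m p q : int) (u v w : affperm n).
Local Notation len := (@aff_length n).
Local Notation tr := (transp n).
Local Notation sr := (@srefl n).

Local Notation V := (nat -> nat -> affperm n -> int).
Implicit Types (f g : V) (r k : nat).

Lemma gradedDE f g r k u : (f + g) r k u = f r k u + g r k u. Proof. by []. Qed.
Lemma gradedBE f g r k u : (f - g) r k u = f r k u - g r k u. Proof. by []. Qed.

Lemma graded_eq (A B : endo V) : (forall f r k u, A f r k u = B f r k u) -> A = B.
Proof.
by move=> AB; apply: endo_eq => f; apply/funext => r; apply/funext => k; apply/funext.
Qed.

(** The value [f r k u] stands for the coefficient of [y ^ r x ^ k]: a weak step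
    carries a factor [y] and a strong cover a factor [x]. The guard discards the
    powers of [y] from [y ^ n] on. *)
Definition weak_fun i f : V := fun r k u =>
  if r is r'.+1 then if (r < n)%N then weak_up i (f r' k) u else 0 else 0.

Fact weak_funD i f g : weak_fun i (f + g) = weak_fun i f + weak_fun i g.
Proof.
apply/funext => -[|r]; apply/funext => k; apply/funext => u /=.
  by [].
by rewrite gradedDE /weak_fun /weak_up; case: ifP => // _; case: ifP.
Qed.
Definition weak_op i : endo V := Endo (weak_funD i).

Lemma weak_funS i f r k : weak_fun i f r.+1 k = if (r.+1 < n)%N then weak_up i (f r k) else fun=> 0.
Proof. by apply/funext => u /=; case: ifP. Qed.

Definition strong_fun m f : V := fun r k u =>
  if k is k'.+1 then strong_down l m (f r k') u else 0.

Fact strong_funD m f g : strong_fun m (f + g) = strong_fun m f + strong_fun m g.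
Proof.
apply/funext => r; apply/funext => -[|k]; apply/funext => u /=.
  by [].
rewrite gradedDE /strong_fun /strong_down.
by rewrite -fsbig_split //; exact: finite_covset.
Qed.
Definition strong_op m : endo V := Endo (strong_funD m).

(** Multiplication by [x y], modulo [y ^ n]. *)
Definition xy_fun f : V := fun r k u =>
  if r is r'.+1 then if k is k'.+1 then if (r < n)%N then f r' k' u else 0
                     else 0 else 0.
Fact xy_funD f g : xy_fun (f + g) = xy_fun f + xy_fun g.
Proof.
apply/funext => r; apply/funext => k; apply/funext => u.
by case: r k => [|r] [|k]; rewrite gradedDE /xy_fun //; case: ifP.
Qed.
Definition xy_op : endo V := Endo xy_funD.

(** Restriction to the elements with the value [p] to the right of [l]. *)
Definition right_fun p f : V := fun r k u => if l < pos u p then f r k u else 0.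
Fact right_funD p f g : right_fun p (f + g) = right_fun p f + right_fun p g.
Proof.
apply/funext => r; apply/funext => k; apply/funext => u.
by rewrite gradedDE /right_fun; case: ifP.
Qed.
Definition right_op p : endo V := Endo (right_funD p).

Local Notation d := weak_op.
Local Notation X := strong_op.
Local Notation e := xy_op.
Local Notation h := right_op.

Lemma strong_down0 m u : strong_down l m (fun=> 0) u = 0.
Proof. exact: fsbig1. Qed.

Lemma strong_down_eq0 m (g : affperm n -> int) u :
  (forall w, g w = 0) -> strong_down l m g u = 0.
Proof. by move=> g0; apply: fsbig1. Qed.

Lemma weak_up0 i u : weak_up i (fun=> 0) u = 0.
Proof. by rewrite /weak_up; case: ifP. Qed.

Lemma e_d i : e * d i = d i * e.
Proof.
apply: graded_eq => f [|[|r]] [|k] u //=; rewrite /weak_up /=;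
  try case: (r.+2 < n)%N; try case: (r.+1 < n)%N; rewrite ?if_same //.
all: by case: (1 < n)%N; rewrite ?if_same.
Qed.

Lemma e_h p : e * h p = h p * e.
Proof.
by apply: graded_eq => f [|r] [|k] u //=; rewrite /right_fun /=; case: ifP => //; case: ifP.
Qed.

Lemma h_h p q : h p * h q = h q * h p.
Proof. by apply: graded_eq => f r k u /=; rewrite /right_fun; case: ifP; case: ifP. Qed.

(** A cover with marking [m] has [m] to the right of [l] at its start and to the
    left of [l] at its end; hence this relation and the next one. *)
Lemma X_h m : X m * h m = X m.
Proof.
apply: graded_eq => f r [|k] u //=; rewrite /right_fun; apply: eq_fsbigr => a /set_mem ca.
by rewrite pos_transp transpR ?(covset_neqmod ca) //; case: ca => _ ->.
Qed.

Lemma h_X m : h m * X m = 0.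
Proof.
apply: graded_eq => f r [|k] u /=; rewrite /right_fun; case: ifP => // lm.
by rewrite /= /strong_down fsbig1 // => a [_ _]; rewrite leNgt lm.
Qed.

Lemma d_mod i c : (i == c %[mod n])%Z -> d i = d c.
Proof.
move=> /eqmodP[q ->]; apply: graded_eq => f [|r] k u //=; case: ifP => // _.
rewrite /weak_up [i + _ + 1]addrAC !posD ltrD2r.
by rewrite (@srefl_mod _ i (i + q * n)) // eq_sym; exact: eqmodD.
Qed.

Lemma d_X i m : ~~ (m == i %[mod n])%Z -> ~~ (m == i + 1 %[mod n])%Z ->
  d i * X m = X m * d i.
Proof.
move=> mi mi'; apply: graded_eq => f [|r] [|k] u //=.
- by rewrite strong_down0.
- by case: ifP; rewrite ?weak_up0.
rewrite weak_funS; case: (r.+1 < n)%N => /=; last by rewrite strong_down0.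
by rewrite weak_up_strong_down.
Qed.

Lemma d_h i m : ~~ (m == i %[mod n])%Z -> ~~ (m == i + 1 %[mod n])%Z ->
  d i * h m = h m * d i.
Proof.
move=> mi mi'; apply: graded_eq => f [|r] k u //=; rewrite /right_fun ?if_same //.
rewrite /= /weak_up; case: ifP => rn; rewrite ?if_same //.
by rewrite pos_srefl transpN //; case: ifP; case: ifP.
Qed.

Lemma d_X_succ p : d p * X (p + 1) = X p * d p + e * (1 - h p) * h (p + 1).
Proof.
apply: graded_eq => f [|r] [|k] u; rewrite endoDE gradedDE -mulrA !endoME.
- by [].
- by rewrite /= strong_down0.
- by rewrite /= addr0; case: ifP; rewrite ?weak_up0.
rewrite /= ?weak_funS; case: (r.+1 < n)%N => /=; last by rewrite strong_down0 addr0.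
rewrite weak_up_strong_down_succ //; congr (_ + _).
rewrite gradedBE /right_fun [l < pos u p]ltNge.
by case: (pos u p <= l) => /=; case: ifP; rewrite ?subr0 ?subrr.
Qed.

Lemma X_d_succ p : X (p + 1) * d p = d p * X p + e * h p * (1 - h (p + 1)).
Proof.
apply: graded_eq => f [|r] [|k] u; rewrite endoDE gradedDE -mulrA !endoME.
- by [].
- by rewrite /= strong_down0.
- by rewrite /= addr0; case: ifP; rewrite ?weak_up0.
rewrite /= ?weak_funS; case: (r.+1 < n)%N => /=; last by rewrite strong_down0.
rewrite strong_down_succ_weak_up //; congr (_ + _).
rewrite /right_fun gradedBE /right_fun [l < pos u (p + 1)]ltNge.
case: (pos u (p + 1) <= l) => /=; case: ifP; rewrite ?subr0 ?subrr //.
Qed.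

Lemma XX_d p : X (p + 1) * X p * d p = X (p + 1) * e * h p * h (p + 1).
Proof.
apply: graded_eq => f [|r] [|[|k]] u //=.
  by rewrite [LHS]strong_down_eq0 ?[RHS]strong_down_eq0 // => w; apply: strong_down_eq0.
rewrite [strong_fun _ _ _ _]/(strong_down l p (weak_fun p f r.+1 k)) weak_funS.
have [rn|/negPf rn] := boolP (r.+1 < n)%N; last first.
  transitivity (0 : int); [|apply/esym]; apply: strong_down_eq0 => w.
    exact: strong_down0.
  by rewrite /= rn.
rewrite strong_down2_weak_up //; apply: eq_fsbigr => a _; rewrite /= rn /right_fun.
by case: (l < pos _ p).
Qed.

Lemma h_d p : h p * d p = d p * h (p + 1).
Proof.
apply: graded_eq => f [|r] k u /=; rewrite /right_fun /= ?if_same //.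
case: (r.+1 < n)%N; rewrite ?if_same //.
by rewrite /weak_up pos_srefl sreflR //; case: (l < pos u p); rewrite ?if_same.
Qed.

Lemma h_d_X p : h p * d p * X p = 0.
Proof.
rewrite h_d -mulrA; apply: graded_eq => f [|r] [|k] u //=; rewrite /weak_up /right_fun /=.
  by rewrite !if_same.
case: (r.+1 < n)%N => //; case: ifP => // asc; rewrite pos_srefl sreflR //.
case: ifP => // lp; apply: fsbig1 => a [_ _].
by rewrite pos_srefl sreflL // leNgt (lt_trans lp asc).
Qed.

Lemma d_d p : d p * d p = 0.
Proof.
apply: graded_eq => f [|[|r]] k u //=; rewrite /weak_up /= /weak_up ?if_same //.
rewrite !pos_srefl sreflL // sreflR //; case: (boolP (pos u p < _)) => [asc|_].
  by rewrite ltNge (ltW asc) /= !if_same.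
by rewrite if_same.
Qed.

Definition marking_factor m : endo V := 1 + X m.
Definition site_factor m : endo V := marking_factor m - e * h m.
Local Notation T := marking_factor.
Local Notation TT := site_factor.

(** After expansion the products with a weak step between or behind two covers vanish
    or reduce to corrections, by [XX_d] and [h_d_X], and [d_X_succ] and [X_d_succ]
    match what remains. Thus [1 + d p] passes through the two adjacent factors of the
    strong operator while the correction [e * h] moves from one site to the next. *)
Lemma exchange_relation p :
  T (p + 1) * TT p * (1 + d p) = (1 + d p) * TT (p + 1) * T p.
Proof.
rewrite /site_factor; set Ta := T p; set Tb := T (p + 1).
set a := X p; set b := X (p + 1); set D := d p; set x := e * h p; set y := e * h (p + 1).
have bax : b * a * D = b * x.
  rewrite [LHS]XX_d /x -/b -[b * e * _]mulrA -/x -mulrA.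
  have -> : x * h (p + 1) = h (p + 1) * x.
    by rewrite /x -mulrA h_h mulrA e_h mulrA.
  by rewrite mulrA X_h.
have bxD : b * x * D = 0 by rewrite -bax -mulrA d_d mulr0.
have xD : D * y = x * D by rewrite /y mulrA -e_d -mulrA -h_d mulrA.
have xDa : x * D * a = 0 by rewrite /x -2!mulrA [h p * _]mulrA h_d_X mulr0.
have aDa : a * D * a = 0 by rewrite /a -[X in X * _ * _](X_h p) -!mulrA [h p * _]mulrA h_d_X mulr0.
have Db : D * b = a * D + (y - x * h (p + 1)).
  by rewrite [LHS]d_X_succ mulrBr mulr1 mulrBl.
have bD : b * D = D * a + (x - x * h (p + 1)).
  by rewrite [LHS]X_d_succ -/x mulrBr mulr1.
have Dba : D * b * a = y * a.
  rewrite Db mulrDl aDa add0r mulrBl -[x * _ * _]mulrA /x.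
  have -> : e * h p * (h (p + 1) * a) = e * h (p + 1) * (h p * a).
    by rewrite mulrA -[e * _ * _]mulrA h_h !mulrA.
  by rewrite h_X mulr0 subr0.
have Ex : Tb * x = x + b * x by rewrite mulrDl mul1r.
have ExD : Tb * x * D = x * D by rewrite Ex mulrDl bxD addr0.
have Ea : Tb * Ta * D = D + a * D + (b * D + b * x).
  by rewrite -mulrA [Ta * D]mulrDl mul1r [LHS]mulrDl mul1r mulrDr mulrA bax.
have E1 : Tb * (Ta - x) * (1 + D) = Tb * Ta + D + (a * D + b * D - x) - x * D.
  rewrite mulrDr mulr1 mulrBr mulrBl ExD Ex Ea opprD !addrA.
  by rewrite [LHS](ACl (1*4*5*6*2*8*(3*7))) /= addNr addr0.
have Ey : y * Ta = y + y * a by rewrite mulrDr mulr1.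
have DT : D * Ta = D + D * a by rewrite mulrDr mulr1.
have DbT : D * b * Ta = D * b + y * a by rewrite mulrDr mulr1 Dba.
have xDT : x * D * Ta = x * D by rewrite mulrDr mulr1 xDa addr0.
have DTb : D * Tb = D + D * b by rewrite mulrDr mulr1.
have E2 : (1 + D) * (Tb - y) * Ta = Tb * Ta + D + (D * b + D * a - y) - x * D.
  rewrite [(1 + D) * _]mulrDl mul1r [D * _]mulrBr [LHS]mulrDl !mulrBl.
  rewrite Ey DTb [(D + D * b) * Ta]mulrDl DT DbT xD xDT opprD !addrA.
  by rewrite [LHS](ACl (1*4*6*5*2*8*(3*7))) /= addNr addr0.
rewrite E1 E2; congr (_ + _ - _); rewrite Db bD !addrA.
rewrite [LHS](ACl (1*2*4*(3*5))) [RHS](ACl (1*4*3*(2*5))) /= !subrr !addr0.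
by rewrite addrAC.
Qed.

End Operators.
(** * Moving the site around the cycle *)

Lemma sum_ord_recl0 (R : nmodType) m (F : nat -> R) : (0 < m)%N ->
  \sum_(j < m) F j = F 0%N + \sum_(j < m.-1) F j.+1.
Proof. by case: m => // m _; rewrite big_ord_recl. Qed.

Lemma sum_ord_recr0 (R : nmodType) m (F : nat -> R) : (0 < m)%N ->
  \sum_(j < m) F j = \sum_(j < m.-1) F j + F m.-1.
Proof. by case: m => // m _; rewrite big_ord_recr. Qed.

Section Commutation.
Variable n : nat.
Hypothesis n_gt1 : (1 < n)%N.
Variable l : int.
Implicit Types (a b c i m p q s : int) (u v w : affperm n).
Local Notation V := (nat -> nat -> affperm n -> int).
Implicit Types (f g : V) (r k j : nat).
Local Notation d := (@weak_op n).
Local Notation e := (@xy_op n).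
Local Notation h := (@right_op n l).
Local Notation T := (marking_factor n_gt1 l).
Local Notation TT := (site_factor n_gt1 l).

Lemma neqmod_lt a b : a < b -> b < a + n -> ~~ (a == b %[mod n])%Z.
Proof.
move=> ab ban; apply/negP => ab'.
have [|k bE k0] := eqmod_ltD n_gt1 ab; first by rewrite eq_sym.
by move: ban; rewrite bE ltrD2l -{2}[n%:Z]mul1r; znia.
Qed.

Lemma d_d_far i m : ~~ (m == i %[mod n])%Z -> ~~ (m == i + 1 %[mod n])%Z ->
  ~~ (i == m + 1 %[mod n])%Z -> GRing.comm (d i) (d m).
Proof.
move=> mi mi1 im1; have im : ~~ (i == m %[mod n])%Z by rewrite eq_sym.
have m1i : ~~ (m + 1 == i %[mod n])%Z by rewrite eq_sym.
have i1m : ~~ (i + 1 == m %[mod n])%Z by rewrite eq_sym.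
have m1i1 : ~~ (m + 1 == i + 1 %[mod n])%Z by rewrite eqmodD2r.
have i1m1 : ~~ (i + 1 == m + 1 %[mod n])%Z by rewrite eqmodD2r.
apply: graded_eq => f [|[|r]] k u //=; rewrite /weak_up /= /weak_up ?if_same //.
rewrite !pos_srefl !(transpN _ (c := m)) // !(transpN _ (c := m + 1)) //.
rewrite !(transpN _ (c := i)) // !(transpN _ (c := i + 1)) //.
have -> : (srefl n m * (srefl n i * u) = srefl n i * (srefl n m * u))%g.
  by rewrite [RHS]sreflJ ?succ_neqmod // !transpN.
case: (r.+2 < n)%N; case: (r.+1 < n)%N; rewrite ?if_same //.
by case: (pos u i < _); case: (pos u m < _).
Qed.

(** Products over a segment of [k] consecutive residues starting at [s]; [Lam]
    is the generating operator of the weak strips supported on the segment. *)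
Fixpoint weak_run s k : endo V := if k is k'.+1 then d s * weak_run (s + 1) k' else 1.
Fixpoint weak_segment s k : endo V :=
  if k is k'.+1 then (1 + d s) * weak_segment (s + 1) k' else 1.
Local Notation dd := weak_run.
Local Notation Lam := weak_segment.

Lemma LamSr s k : Lam s k.+1 = Lam s k * (1 + d (s + k%:Z)).
Proof.
elim: k s => [|k IH] s; first by rewrite /= mulr1 mul1r addr0.
rewrite [LHS]/= -/(Lam (s + 1) k.+1) IH mulrA; congr (_ * (1 + d _)).
by rewrite -addrA.
Qed.

Lemma comm_dd A s k :
  (forall i, s <= i < s + k%:Z -> GRing.comm A (d i)) -> GRing.comm A (dd s k).
Proof.
elim: k s => [|k IH] s H /=; first exact: commr1.
apply: commrM; first by apply: H; zlia.
by apply: IH => i si; apply: H; zlia.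
Qed.

Lemma comm_Lam A s k :
  (forall i, s <= i < s + k%:Z -> GRing.comm A (d i)) -> GRing.comm A (Lam s k).
Proof.
elim: k s => [|k IH] s H /=; first exact: commr1.
apply: commrM; first by apply: commrD; [exact: commr1|apply: H; zlia].
by apply: IH => i si; apply: H; zlia.
Qed.

Lemma comm_T_d p i : p < i -> i < p + n - 1 -> GRing.comm (T p) (d i).
Proof.
move=> pi ipn; apply/commr_sym/commrD; first exact: commr1.
by apply: d_X; rewrite neqmod_lt //; zlia.
Qed.

Lemma comm_TT_d p i : p < i -> i < p + n - 1 -> GRing.comm (TT p) (d i).
Proof.
move=> pi ipn; apply/commr_sym/commrB; first exact/commr_sym/comm_T_d.
apply: commrM; first exact/commr_sym/e_d.
by apply: d_h; rewrite neqmod_lt //; zlia.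
Qed.

(** Expansion of the subsets of the segment by their first gap. *)
Lemma Lam_first_gap s k :
  Lam s k = \sum_(j < k) dd s j * Lam (s + j%:Z + 1) (k - j.+1) + dd s k.
Proof.
elim: k s => [|k IH] s /=; first by rewrite big_ord0 add0r.
rewrite big_ord_recl /= mul1r addr0 subn1 /= mulrDl mul1r -addrA; congr (_ + _).
rewrite IH mulrDr mulr_sumr; congr (_ + _); apply: eq_bigr => j _.
rewrite mulrA; congr (_ * Lam _ _).
by rewrite /bump /= add1n; zlia.
Qed.

Lemma dd_vanish s k f r : (forall r' t u, (r' + k)%N = r -> f r' t u = 0) ->
  forall t u, dd s k f r t u = 0.
Proof.
elim: k s r => [|k IH] s [|r] H t u; rewrite ?endoME //=.
- by apply: H; rewrite addn0.
- by apply: H; rewrite addn0.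
case: ifP => // _; rewrite /weak_up; case: ifP => // _.
by apply: IH => r' t' u' rE; apply: H; rewrite addnS rE.
Qed.

(** A product of [n - 1] weak steps with a correction has degree [n] in [y]. *)
Lemma dd_e s : dd s n.-1 * e = 0.
Proof.
apply: graded_eq => f r t u; rewrite endoME; have [rn|nr] := ltnP r n.
  by apply: dd_vanish => -[|r'] t' u' //; zlia.
have [k ->] : exists k, n.-1 = k.+1 by exists n.-2; zlia.
by case: r nr => //= r; rewrite ltnNge => ->.
Qed.

(** The weak operator, with an operator [Z] inserted at the site [p] of the
    cycle: the links from [p] up to the first gap act before [Z], all others
    after it. *)
Definition weak_at p (Z : endo V) : endo V :=
  \sum_(j < n) Lam (p + j%:Z + 1) (n - j.+1) * Z * dd p j.

(** The correction travels around the cycle together with the site: moving the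
    site past [p] exchanges the marking [p + 1], still to be processed, with
    the marking [p], just processed. Only the term with no gap but [p] itself is
    not covered by the local relation; there the correction has degree [n]. *)
Lemma site_shift p :
  T (p + 1) * weak_at p (TT p) = weak_at (p + 1) (TT (p + 1)) * T p.
Proof.
pose L j := T (p + 1) * Lam (p + j%:Z + 1) (n - j.+1) * TT p * dd p j.
pose B (j : nat) := T (p + 1) * Lam (p + j%:Z + 2%:Z) (n - j.+2) * TT p * dd (p + 1) j.
have R j : (j < n.-1)%N ->
    Lam (p + 1 + j%:Z + 1) (n - j.+1) * TT (p + 1) * dd (p + 1) j * T p = B j + L j.+1.
  move=> jn.
  have -> : (n - j.+1)%N = (n - j.+2).+1 by zlia.
  rewrite LamSr (@d_mod n _ p); last first.
    have -> : p + 1 + j%:Z + 1 + (n - j.+2)%N%:Z = p + 1%:Z * n by zlia.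
    exact: eqmodD.
  have cT : GRing.comm (T p) (dd (p + 1) j) by apply: comm_dd => i ?; apply: comm_T_d; zlia.
  have -> : p + 1 + j%:Z + 1 = p + j%:Z + 2%:Z by zlia.
  have cL : GRing.comm (T (p + 1)) (Lam (p + j%:Z + 2%:Z) (n - j.+2)).
    by apply: comm_Lam => i ?; apply: comm_T_d; zlia.
  transitivity (Lam (p + j%:Z + 2%:Z) (n - j.+2) * ((1 + d p) * TT (p + 1) * T p) * dd (p + 1) j).
    by rewrite -!mulrA cT.
  rewrite -exchange_relation !mulrA -cL -[_ * (1 + d p) * _]mulrA.
  have -> : (1 + d p) * dd (p + 1) j = dd (p + 1) j + dd p j.+1 by rewrite mulrDl mul1r.
  rewrite [LHS]mulrDr.
  have pE : p + j%:Z + 2%:Z = p + j.+1%:Z + 1 by zlia.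
  by rewrite /L -pE.
have N : T (p + 1) * Lam (p + 1) n.-1 * TT p =
    \sum_(j < n.-1) B j + TT (p + 1) * dd (p + 1) n.-1 * T p.
  rewrite Lam_first_gap [T (p + 1) * (_ + dd _ _)]mulrDr [LHS]mulrDl mulr_sumr mulr_suml.
  congr (_ + _).
    apply: eq_bigr => -[j jn] _ /=; rewrite /B.
    have -> : p + 1 + j%:Z + 1 = p + j%:Z + 2%:Z by zlia.
    have -> : (n.-1 - j.+1 = n - j.+2)%N by zlia.
    have c1 : GRing.comm (TT p) (dd (p + 1) j) by apply: comm_dd => i ?; apply: comm_TT_d; zlia.
    have c2 : GRing.comm (Lam (p + j%:Z + 2%:Z) (n - j.+2)) (dd (p + 1) j).
      apply: comm_dd => i ?; apply/commr_sym/comm_Lam => i' ?.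
      by apply: d_d_far; [rewrite eq_sym|rewrite eq_sym|]; apply: neqmod_lt; zlia.
    by rewrite -c2 -!mulrA -c1.
  have eh : forall q, e * h q = h q * e by exact: e_h.
  rewrite /site_factor !(mulrBr, mulrBl) -!mulrA [dd _ _ * (_ * _)]mulrA dd_e !(mul0r, mulr0).
  congr (_ - _); rewrite mulrA eh -mulrA.
  have -> : e * (dd (p + 1) n.-1 * T p) = 0.
    have ed : e * dd (p + 1) n.-1 = dd (p + 1) n.-1 * e.
      by apply: comm_dd => i _; exact: e_d.
    by rewrite mulrA ed dd_e mul0r.
  by rewrite mulr0.
transitivity (\sum_(j < n) L j).
  by rewrite mulr_sumr; apply: eq_bigr => j _; rewrite /L !mulrA.
rewrite mulr_suml sum_ord_recl0 ?(ltnW n_gt1) // {1}/L /= mulr1 addr0 subn1 N.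
rewrite (@sum_ord_recr0 _ n (fun j =>
  Lam (p + 1 + j%:Z + 1) (n - j.+1) * TT (p + 1) * dd (p + 1) j * T p)) ?(ltnW n_gt1) //.
rewrite addrAC -big_split /=; congr (_ + _).
  by apply: eq_bigr => j _; rewrite R.
by rewrite prednK ?(ltnW n_gt1) // subnn /= mul1r.
Qed.

End Commutation.

(** * The commutation relation for long segments of markings *)

Section Limits.
Variable n : nat.
Hypothesis n_gt1 : (1 < n)%N.
Variable l : int.
Implicit Types (a b c i m p q s : int) (u v w : affperm n) (B N : nat).
Local Notation V := (nat -> nat -> affperm n -> int).
Implicit Types (f g : V) (r k j : nat).
Local Notation len := (@aff_length n).
Local Notation tr := (transp n).
Local Notation d := (@weak_op n).
Local Notation e := (@xy_op n).
Local Notation h := (@right_op n l).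
Local Notation X := (strong_op n_gt1 l).
Local Notation T := (marking_factor n_gt1 l).
Local Notation TT := (site_factor n_gt1 l).
Local Notation Lam := (@weak_segment n).
Local Notation dd := (@weak_run n).

(** The operator of the strong strips with markings in a segment of [N]
    integers starting at [s]; the rightmost factor, of the smallest marking,
    corresponds to the first cover. *)
Fixpoint strong_segment s N : endo V :=
  if N is N'.+1 then T (s + N'%:Z) * strong_segment s N' else 1.

Lemma site_shifts s N :
  weak_at (s + N%:Z) (TT (s + N%:Z)) * strong_segment s N = strong_segment (s + 1) N * weak_at s (TT s).
Proof.
elim: N => [|N IH]; first by rewrite addr0 /= mulr1 mul1r.
have -> : s + N.+1%:Z = s + N%:Z + 1 by zlia.
by rewrite /= mulrA -site_shift -!mulrA IH addrAC.
Qed.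

(** The colouring of the values by the position bound [l] is trivial outside
    the segment from [- B] to [B]. *)
Definition bounded B u := forall p, (p <= - B%:Z -> pos u p <= l) /\ (B%:Z <= p -> l < pos u p).

Lemma bounded_exists u : exists B, bounded B u.
Proof.
have [N uN] := pos_bounded n_gt1 u; exists (N + `|l| + 1)%N => p.
by have := uN p; split; zlia.
Qed.

Lemma bounded_le B B' u : (B <= B')%N -> bounded B u -> bounded B' u.
Proof.
by move=> BB uB p; have [u1 u2] := uB p; split=> pB; [apply: u1|apply: u2]; zlia.
Qed.

Lemma bounded_srefl B i u : bounded B u -> bounded B.+1 (srefl n i * u)%g.
Proof.
move=> uB p; rewrite !pos_srefl.
case: (srefl_cases n_gt1 i p) => [[_ ->]|[_ ->]|[_ _ ->]].
- by have [u1 u2] := uB (p + 1); split=> pB; [apply: u1|apply: u2]; zlia.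
- by have [u1 u2] := uB (p - 1); split=> pB; [apply: u1|apply: u2]; zlia.
- by have [u1 u2] := uB p; split=> pB; [apply: u1|apply: u2]; zlia.
Qed.

Lemma bounded_cover B u m a : covset l u m a -> bounded B u -> bounded B (tr a m * u)%g.
Proof.
move=> ca uB p; have nam := covset_neqmod ca; case: ca => am la lm _.
have lt := le_lt_trans lm la.
rewrite !pos_transp; have [pa|pa] := boolP (p == a %[mod n])%Z.
  case/eqmodP: (pa) => k aE; have pE : p = a + (- k) * n by rewrite aE; ring.
  have [u1 u2] := uB p; have [u3 u4] := uB (m + (- k) * n).
  rewrite {2 4}pE affpermD transpL //; split=> pB; last by apply: u4; zlia.
  by apply: le_trans (u1 pB); rewrite pE !posD lerD2r ltW.
have [pm|pm] := boolP (p == m %[mod n])%Z; last by rewrite transpN.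
case/eqmodP: (pm) => k mE; have pE : p = m + (- k) * n by rewrite mE; ring.
have [u1 u2] := uB p; have [u3 u4] := uB (a + (- k) * n).
rewrite {2 4}pE affpermD transpR //; split=> pB; first by apply: u3; zlia.
by apply: lt_trans (u2 pB) _; rewrite pE !posD ltrD2r.
Qed.

Lemma covset_bounded B u m a : covset l u m a -> bounded B u -> - B%:Z < m < B%:Z.
Proof.
by move=> [am la lm _] uB; have [u1 _] := uB a; have [_ u4] := uB m; zlia.
Qed.

(** Steps widen the bound by one at most, so operators that agree on the elements
    with a sufficiently large bound can be exchanged inside a weak operator. *)
Definition agree B f g := forall w, bounded B w -> forall r k, f r k w = g r k w.

Lemma agree_d B i f g : agree B.+1 f g -> agree B (d i f) (d i g).
Proof.
move=> fg w wB [|r] k //=; case: ifP => // _; rewrite /weak_up; case: ifP => // _.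
by apply: fg; exact: bounded_srefl.
Qed.

Lemma agree_le B B' f g : (B <= B')%N -> agree B' f g -> agree B f g.
Proof. by move=> BB fg w wB; apply: fg; exact: bounded_le wB. Qed.

Lemma agreeD B f f' g g' : agree B f g -> agree B f' g' -> agree B (f + f') (g + g').
Proof. by move=> fg fg' w wB r k; rewrite !gradedDE fg ?fg'. Qed.

Lemma agree_Lam B s j f g : agree (B + j) f g -> agree B (Lam s j f) (Lam s j g).
Proof.
elim: j s B => [|j IH] s B; first by rewrite addn0.
move=> fg /=; apply: agreeD; last apply: agree_d; apply: IH.
  by apply: agree_le fg; zlia.
by rewrite addSnnS.
Qed.

Lemma agree_X B m f g : agree B f g -> agree B (X m f) (X m g).
Proof.
move=> fg w wB r [|k] //=; apply: eq_fsbigr => a /set_mem ca.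
by rewrite fg //; exact: bounded_cover ca wB.
Qed.

Lemma agree_strong_segment B s N f g : agree B f g -> agree B (strong_segment s N f) (strong_segment s N g).
Proof.
move=> fg; elim: N => //= N IH.
by apply: agreeD => //; apply: agree_X.
Qed.

Lemma agree_weak_at B p (Z Z' : endo V) f : (forall g, agree (B + n) (Z g) (Z' g)) ->
  agree B (weak_at p Z f) (weak_at p Z' f).
Proof.
move=> ZZ w wB r k; rewrite /weak_at !endo_sumE.
elim/big_rec2: _ => // j x y _; rewrite !gradedDE => ->; congr (_ + _).
rewrite !endoME; apply: agree_Lam wB r k.
by apply: agree_le (ZZ _); rewrite leq_add2l leq_subr.
Qed.

(** Far to the left no value is to the right of [l], and no cover has such a
    marking. *)
Lemma agree_TT_low B s g : s <= - B%:Z -> agree B (TT s g) ((1 : endo V) g).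
Proof.
move=> sB w wB r k; have lo p : p <= s -> pos w p <= l.
  by move=> ps; have [+ _] := wB p; apply; zlia.
have X0 : X s g r k w = 0.
  case: k => //= k; rewrite /strong_down fsbig1 // => a [as_ la _ _].
  by have := lo a (ltW as_); rewrite leNgt la.
have e0 : e (h s g) r k w = 0.
  by case: r k {X0} => [|r] [|k] //=; rewrite /right_fun ltNge lo // if_same.
have -> : TT s g = g + X s g - e (h s g) by [].
by rewrite gradedBE gradedDE X0 e0 addr0 subr0.
Qed.

(** Far to the right all values are to the right of [l], and the correction is
    [x y] itself. *)
Lemma agree_TT_high B s g : B%:Z <= s -> agree B (TT s g) ((1 - e) g).
Proof.
move=> sB w wB r k; have hi : l < pos w s by have [_ +] := wB s; apply.
have X0 : X s g r k w = 0.
  case: k => //= k; rewrite /strong_down fsbig1 // => a [_ _ + _].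
  by rewrite leNgt hi.
have e1 : e (h s g) r k w = e g r k w.
  by case: r k {X0} => [|r] [|k] //=; rewrite /right_fun hi.
have -> : TT s g = g + X s g - e (h s g) by [].
by rewrite endoBE !gradedBE gradedDE X0 e1 addr0.
Qed.

Lemma weak_at_xy p : weak_at p (1 - e) = (1 - e) * weak_at p 1 :> endo V.
Proof.
rewrite /weak_at mulr_sumr; apply: eq_bigr => j _; rewrite mulr1 mulrA; congr (_ * _).
apply/esym/(comm_Lam n_gt1) => i _; apply/commr_sym/commrB.
  exact: commr1.
by apply/commr_sym; exact: e_d.
Qed.

(** On elements with a small bound the site factor is [1] at the start of the segment
    and [1 - e] at its end, so [site_shifts] becomes a commutation relation. *)
Lemma weak_strong B s N f u r k : bounded B u ->
    s <= - (B + n)%N%:Z -> (B + n)%N%:Z <= s + N%:Z ->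
  weak_at (s + N%:Z) 1 (strong_segment s N f) r k u - e (weak_at (s + N%:Z) 1 (strong_segment s N f)) r k u =
  strong_segment (s + 1) N (weak_at s 1 f) r k u.
Proof.
move=> uB slo shi.
have := congr1 (fun A : endo V => A f r k u) (site_shifts s N); rewrite !endoME.
rewrite (@agree_weak_at B _ _ (1 - e) _ _ u uB); last by move=> g; apply: agree_TT_high.
rewrite weak_at_xy endoME endoBE gradedBE endo1E => ->.
apply: (agree_strong_segment _ _ _ uB) => //; apply: agree_weak_at => g; exact: agree_TT_low.
Qed.

End Limits.

(** * Products of marking factors and strong strips *)

Section StrongSums.
Variable n : nat.
Hypothesis n_gt1 : (1 < n)%N.
Variable l : int.
Implicit Types (a b c i m p q s M : int) (u v w : affperm n) (B N : nat).
Implicit Types (C : cover_data n).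
Local Notation V := (nat -> nat -> affperm n -> int).
Local Notation len := (@aff_length n).
Local Notation tr := (transp n).

Definition covers_to u : set (cover_data n) :=
  [set C | marked_strong_cover l C /\ out C = u].

Definition cover_of u m a : cover_data n :=
  CoverData (tr a m * u)%g u (pos u m, pos u a).

Lemma cover_ofP u m a : covset l u m a ->
  covers_to u (cover_of u m a) /\ marking (cover_of u m a) = m.
Proof.
move=> ca; have nam := covset_neqmod ca; case: (ca) => am la lm lu.
split; last by rewrite /marking affpermM posK transpL.
have nji : ~~ (pos u m == pos u a %[mod n])%Z by rewrite pos_eqmod eq_sym.
have uE : u = (tr a m * u * tr (pos u m) (pos u a))%g.
  rewrite -mulgA transpJ // !posK [tr m a]transpC mulgA transpK mul1g //.
split=> //; split=> //=; last by rewrite lm.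
by split=> //; exists (pos u m), (pos u a).
Qed.

Lemma ins_cover_of u m a : covset l u m a ->
  ins (cover_of u m a) (ind (cover_of u m a)).1 = a.
Proof.
move=> /covset_neqmod nam.
have -> : ins (cover_of u m a) (ind (cover_of u m a)).1 = tr a m (u (pos u m)) by [].
by rewrite posK transpR.
Qed.

Lemma covers_toP u C : covers_to u C ->
  exists2 a, covset l u (marking C) a & C = cover_of u (marking C) a.
Proof.
case: C => w x [i j] [/= H xu]; rewrite /= in xu; subst x.
case: H => -[lu _] nij uE /andP[il lj]; rewrite /= in lu uE.
have nwij : ~~ (w i == w j %[mod n])%Z by rewrite affperm_eqmod.
have wu : w = (tr (w i) (w j) * u)%g by rewrite uE transpJ // transpKM.
have ui : u i = w j by rewrite uE affpermM transpL.
have uj : u j = w i by rewrite uE affpermM transpR.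
have pj : pos u (w j) = i by rewrite -ui Kpos.
have pi : pos u (w i) = j by rewrite -uj Kpos.
rewrite /marking /=; exists (w i); last by rewrite /cover_of -wu pj pi.
split; rewrite ?pj ?pi -?wu //.
rewrite ltNge le_eqVlt; apply/negP => /orP[/eqP e|lt].
  by move: nwij; rewrite e eqxx.
have nwji : ~~ (w j == w i %[mod n])%Z by rewrite eq_sym.
have := len_transpE n_gt1 u lt nwji; rewrite transpC -wu lu ltnSn pj pi.
by move/esym; zlia.
Qed.

Lemma finite_covers_to u : finite_set (covers_to u).
Proof.
have [B uB] := bounded_exists n_gt1 l u.
have sub : covers_to u `<=` \bigcup_(m in [set m : int | - B%:Z <= m < B%:Z])
    [set cover_of u m a | a in covset l u m].
  move=> C uC; have [a ca CE] := covers_toP uC; exists (marking C) => /=.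
    by have := covset_bounded n_gt1 ca uB; zlia.
  by exists a.
apply: sub_finite_set sub _; apply: bigcup_finite; first exact: finite_int_segment.
by move=> m _; apply/finite_image/finite_covset.
Qed.

Definition covl u : seq (cover_data n) := fset_set (covers_to u).

Lemma covl_uniq u : uniq (covl u). Proof. exact: fset_uniq. Qed.

Lemma mem_covl u C : reflect (covers_to u C) (C \in covl u).
Proof. by rewrite /covl in_fset_set; [exact: asboolP|exact: finite_covers_to]. Qed.

Lemma strong_down_covl m (g : affperm n -> int) u :
  strong_down l m g u = \sum_(C <- covl u | marking C == m) g (ins C).
Proof.
rewrite -big_filter [RHS]fsbig_seq; last by rewrite filter_uniq // covl_uniq.
rewrite [RHS](@reindex_fsbig_can _ _ (cover_of u m) (fun C => ins C (ind C).1) (covset l u m)) //.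
- move=> a /cover_ofP[ca cm] /=.
  by rewrite mem_filter cm eqxx; apply/mem_covl.
- move=> C /=; rewrite mem_filter => /andP[/eqP <- /mem_covl/covers_toP[a ca ->]].
  by rewrite ins_cover_of // (cover_ofP ca).2.
- by move=> a; exact: ins_cover_of.
- move=> C /=; rewrite mem_filter => /andP[/eqP <- /mem_covl/covers_toP[a ca ->]].
  by rewrite (cover_ofP ca).2 ins_cover_of.
Qed.

(** Sums over the strong strips of size [k] ending at [u] with all markings
    below [M]: [f] is evaluated at the start. *)
Fixpoint strip_sum k M (f : affperm n -> int) u : int :=
  if k is k'.+1 then \sum_(C <- covl u | marking C < M) strip_sum k' (marking C) f (ins C)
  else f u.

Lemma covl_bounded B u C : bounded l B u -> C \in covl u ->
  - B%:Z < marking C < B%:Z /\ bounded l B (ins C).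
Proof.
move=> uB /mem_covl/covers_toP[a ca ->]; have [_ cm] := cover_ofP ca.
split; last exact: (bounded_cover n_gt1 ca uB).
by rewrite cm; have := covset_bounded n_gt1 ca uB.
Qed.

(** All markings that occur below [u] lie above the lower end of the segment; its
    upper end bounds the last, largest marking. *)
Lemma strong_segment_strip_sum B s N (g : V) u r k : bounded l B u -> s <= - B%:Z ->
    (forall k u, g r k.+1 u = 0) ->
  strong_segment n_gt1 l s N g r k u = strip_sum k (s + N%:Z) (g r 0%N) u.
Proof.
move=> uB sB g0; elim: N u uB k => [|N IH] u uB [|k] //=.
- rewrite addr0 g0 big_seq_cond big1 // => C /andP[Cu].
  by have [] := covl_bounded uB Cu; zlia.
- by rewrite gradedDE /= addr0; exact: (IH u uB 0%N).
rewrite [LHS]gradedDE IH //= strong_down_covl.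
rewrite [RHS](bigID (fun C => marking C == s + N%:Z)) /= addrC.
congr (_ + _).
  by apply: eq_bigl => C; zlia.
rewrite big_seq_cond [RHS]big_seq_cond; apply: eq_big => C.
  by case: (C \in _) => //=; zlia.
move=> /andP[Cu /eqP mC]; have [_ wB] := covl_bounded uB Cu.
by rewrite IH // mC.
Qed.

End StrongSums.
(** * Products of weak steps and subsets of the cycle *)

Lemma sum_subset_setU1 (I : finType) (R : nmodType) (x : I) (W : {set I})
    (F : {set I} -> R) : x \notin W ->
  \sum_(A : {set I} | A \subset x |: W) F A =
  \sum_(A : {set I} | A \subset W) F A + \sum_(A : {set I} | A \subset W) F (x |: A)%SET.
Proof.
move=> xW; rewrite (bigID (fun A : {set I} => x \notin A)) /=; congr (_ + _).
  apply: eq_bigl => A; apply/andP/idP => [[AW xA]|AW].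
    apply/fintype.subsetP => y yA; have := fintype.subsetP AW y yA.
    by rewrite !inE => /orP[/eqP yx|//]; rewrite yx (negPf xA) in yA.
  split; first by rewrite (fintype.subset_trans AW) // finset.subsetUr.
  by apply: contra xW; exact: fintype.subsetP.
rewrite (reindex_onto (fun A : {set I} => (x |: A)%SET) (fun A => (A :\ x)%SET)) /=; last first.
  by move=> A /andP[_]; rewrite negbK => xA; rewrite finset.setD1K.
apply: eq_bigl => A; rewrite finset.setU11 /= andbT; apply/andP/idP.
  move=> [AW /eqP A1]; apply/fintype.subsetP => y; rewrite -A1 !inE => /andP[yx].
  rewrite (negPf yx) /= => yA; have : y \in (x |: A)%SET by rewrite !inE yA orbT.
  by move/(fintype.subsetP AW); rewrite !inE (negPf yx).
move=> AW; split; first exact: finset.setUS.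
by rewrite finset.setU1K //; apply: contra xW; exact: fintype.subsetP.
Qed.

Section WeakSums.
Variable n : nat.
Hypothesis n_gt1 : (1 < n)%N.
Implicit Types (a b c i m p q s : int) (u v w : affperm n).
Local Notation V := (nat -> nat -> affperm n -> int).
Implicit Types (f g : V) (r k j : nat) (A : {set 'Z_n}) (ks : seq int).
Local Notation len := (@aff_length n).
Local Notation d := (@weak_op n).
Local Notation dd := (@weak_run n).
Local Notation Lam := (@weak_segment n).
Local Notation cls i := (i%:~R : 'Z_n).

(** Applying simple reflections from the left, in the order of the list. *)
Fixpoint left_word ks u : affperm n :=
  if ks is i :: ks' then left_word ks' (srefl n i * u)%g else u.

Lemma left_word_cat ks ks' u : left_word (ks ++ ks') u = left_word ks' (left_word ks u).
Proof. by elim: ks u => //= i ks IH u. Qed.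

Lemma left_word_mul ks u : left_word ks u = (left_word ks 1 * u)%g.
Proof.
elim: ks u => [|i ks IH] u; first by rewrite mul1g.
by rewrite /= IH [in RHS]IH mulg1 mulgA.
Qed.

Lemma len_left_word ks u : (len (left_word ks u) <= len u + size ks)%N.
Proof.
elim: ks u => [|i ks IH] u /=; first by rewrite addn0.
by apply: leq_trans (IH _) _; rewrite addnS -addSn leq_add2r len_srefl_le.
Qed.

Definition weak_prod ks : endo V := \prod_(i <- ks) d i.

(** The product of weak steps survives exactly when every step goes up, which is
    detected by the total length. *)
Lemma weak_prodE ks f r k u : (r < n)%N -> weak_prod ks f r k u =
  if (size ks <= r)%N && (len (left_word ks u) == len u + size ks)%N
  then f (r - size ks)%N k (left_word ks u) else 0.
Proof.
rewrite /weak_prod; elim: ks r u => [|i ks IH] r u rn.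
  by rewrite big_nil /= addn0 eqxx subn0.
rewrite big_cons endoME; case: r rn => //= r rn; rewrite rn /weak_up ltnS subSS.
case: ifP => asc.
  by rewrite IH ?(ltnW rn) // len_srefl_asc // addSnnS.
case: ifP => // /andP[_ /eqP lw]; have := len_left_word ks (srefl n i * u)%g.
rewrite lw (len_srefl_desc n_gt1 (u := u) (i := i)); first by zlia.
by move: asc; rewrite pos_ltgt // => /negbFE.
Qed.

Fixpoint cls_segment s k : {set 'Z_n} := if k is k'.+1 then (cls s |: cls_segment (s + 1) k')%SET else finset.set0.

Lemma in_cls_segment s k (x : 'Z_n) :
  reflect (exists2 j, (j < k)%N & x = cls (s + j%:Z)) (x \in cls_segment s k).
Proof.
elim: k s x => [|k IH] s x /=; first by rewrite inE; constructor=> -[].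
rewrite in_setU1; apply: (iffP orP) => [[/eqP ->|/IH[j jk ->]]|[[|j] jk ->]].
- by exists 0%N; rewrite ?addr0.
- by exists j.+1 => //; congr (cls _); zlia.
- by left; rewrite addr0.
- by right; apply/IH; exists j => //; congr (cls _); zlia.
Qed.

Definition links s k A : seq int := [seq i <- [seq s + j%:Z | j <- iota 0 k] | cls i \in A].

Lemma linksS s k A :
  links s k.+1 A = if cls s \in A then s :: links (s + 1) k A else links (s + 1) k A.
Proof.
rewrite /links /= addr0 -[1%N]addn0 iotaDl -map_comp.
have -> : [seq ((fun j : nat => s + j%:Z) \o addn 1) j | j <- iota 0 k] =
          [seq s + 1 + j%:Z | j <- iota 0 k].
  by apply: eq_map => j /=; rewrite PoszD addrA.
by [].
Qed.

Lemma links_cat s k j A : links s (k + j) A = links s k A ++ links (s + k%:Z) j A.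
Proof.
elim: k s => [|k IH] s; first by rewrite addr0.
rewrite addSn !linksS IH (_ : s + 1 + k%:Z = s + k.+1%:Z); last by zlia.
by case: ifP.
Qed.

Lemma eq_links s k A A' : (forall j, (j < k)%N -> (cls (s + j%:Z) \in A) = (cls (s + j%:Z) \in A')) ->
  links s k A = links s k A'.
Proof.
move=> AA; apply: eq_in_filter => i /mapP[j]; rewrite mem_iota /= => jk ->.
exact: AA.
Qed.

Lemma cls_neq s j k : (j < k)%N -> (k < j + n)%N -> cls (s + j%:Z) <> cls (s + k%:Z).
Proof.
move=> jk kn /eqP; rewrite Zint_eq //; apply/negP/neqmod_lt => //; zlia.
Qed.

Lemma head_notin_cls_segment s k : (k < n)%N -> cls s \notin cls_segment (s + 1) k.
Proof.
move=> kn; apply/in_cls_segment => -[j jk]; rewrite -{1}[s]addr0 -addrA.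
by apply: (@cls_neq s 0%N j.+1); zlia.
Qed.

Lemma Lam_subsets s k : (k <= n)%N ->
  Lam s k = \sum_(A : {set 'Z_n} | A \subset cls_segment s k) weak_prod (links s k A).
Proof.
elim: k s => [|k IH] s kn /=.
  rewrite (big_pred1 finset.set0) ?/weak_prod ?big_nil // => A; exact: finset.subset0.
rewrite sum_subset_setU1 ?head_notin_cls_segment // mulrDl mul1r IH ?(ltnW kn) //.
have sA A : A \subset cls_segment (s + 1) k -> cls s \notin A.
  by move=> AW; apply: contra (head_notin_cls_segment s kn); exact: fintype.subsetP.
congr (_ + _).
  by apply: eq_bigr => A /sA/negPf AW; rewrite linksS AW.
rewrite mulr_sumr; apply: eq_bigr => A AW; rewrite linksS finset.setU11 /weak_prod big_cons.
suff -> : links (s + 1) k (cls s |: A)%SET = links (s + 1) k A by [].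
apply: eq_links => j jk; rewrite finset.in_setU1; case: eqP => // e; exfalso; move/esym: e.
rewrite -{1}[s]addr0 -addrA; apply: (@cls_neq s 0%N j.+1); zlia.
Qed.

End WeakSums.

(** * The permutation of a cyclically decreasing product *)

Section CyclicallyDecreasing.
Variable n : nat.
Hypothesis n_gt1 : (1 < n)%N.
Implicit Types (i m p q s t : int) (u v w : affperm n).
Implicit Types (k j : nat) (A I J : {set 'Z_n}) (a b x : 'Z_n).
Local Notation cls i := (i%:~R : 'Z_n).
Local Notation sr := (@srefl n).

(** The function of the cyclically decreasing element of [A]: on each run of
    [A], followed by one more residue, the first value moves to the end and all
    others move one step down. *)
Definition rot_spec A (g : int -> int) : Prop := forall i,
  cls (i - 1) \in A /\ g i = i - 1 \/
  [/\ cls (i - 1) \notin A, i <= g i, cls (g i) \notin A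
    & forall t, i <= t < g i -> cls t \in A].

Lemma rot_spec_uniq A g g' : rot_spec A g -> rot_spec A g' -> g =1 g'.
Proof.
move=> G G' i; case: (G i) (G' i) => [[iA ->]|[iA gi gA gB]] [[iA' ->]|[iA' gi' gA' gB']] //.
- by rewrite iA in iA'.
- by rewrite iA' in iA.
case: (ltgtP (g i) (g' i)) => // lt.
- by move: gA; rewrite gB' // gi.
- by move: gA'; rewrite gB // gi'.
Qed.

(** On one period after the gap [q] the links form a linear chain; adding them one by
    one extends the last run or starts a new one. *)
Lemma left_word_links_window A q k : cls q \notin A -> (k < n)%N ->
    let g := left_word (links (q + 1) k A) (1%g : affperm n) in let c := q + k%:Z + 1 in
  forall i, q < i <= q + n ->
  [\/ c < i /\ g i = i,
      [/\ q + 1 < i <= c, cls (i - 1) \in A & g i = i - 1] |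
      [/\ i <= c, cls (i - 1) \notin A, i <= g i <= c, (cls (g i) \notin A \/ g i = c)
        & forall t, i <= t < g i -> cls t \in A]].
Proof.
move=> qA; elim: k => [|k IH] kn g c i iq.
  have [->|ic] := eqVneq i (q + 1); last by constructor 1; split=> //; rewrite /c; zlia.
  rewrite /g /c addr0 addrK; constructor 3; split=> //.
  - by rewrite /= lexx.
  - by right.
  - by move=> t /=; zlia.
pose c0 := q + k%:Z + 1; have cE : c = c0 + 1 by rewrite /c /c0; zlia.
have gE : g = ((if cls c0 \in A then sr c0 else 1) * left_word (links (q + 1) k A) (1 : affperm n))%g.
  rewrite /g -[k.+1]addn1 (links_cat n_gt1) left_word_cat linksS (_ : q + 1 + k%:Z = c0); last first.
    by rewrite /c0; zlia.
  by case: ifP; rewrite /= ?mul1g.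
have := IH (ltnW kn) i iq; rewrite -/c0 gE; move: (left_word _ _) => g0 {IH gE g}.
have fix_ y : q < y <= q + n -> y != c0 -> y != c0 + 1 -> sr c0 y = y.
  move=> yq y1 y2; case: (ltgtP y c0) y1 => // yc _; apply: transpN.
  - by apply: neqmod_lt => //; rewrite /c0; zlia.
  - by apply: neqmod_lt => //; rewrite /c0; zlia.
  - by rewrite eq_sym; apply: neqmod_lt => //; rewrite /c0; zlia.
  - case: (ltgtP y (c0 + 1)) y2 => // yc2 _; first by zlia.
    by rewrite eq_sym; apply: neqmod_lt => //; rewrite /c0; zlia.
case: (boolP (cls c0 \in A)) => cA; rewrite affpermM ?affperm1; last first.
  case=> [[ci ->]|[iq' iA ->]|[ic iA gi gA gB]].
  - have [e|ne] := eqVneq i c; last by constructor 1; zlia.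
    constructor 3; rewrite e cE addrK; split=> //; rewrite ?lexx //; first by right.
    by move=> t; zlia.
  - by constructor 2; split=> //; zlia.
  - constructor 3; split=> //; try zlia.
    by left; case: gA => // ->.
case=> [[ci ->]|[iq' iA ->]|[ic iA gi gA gB]].
- have [e|ne] := eqVneq i c.
    constructor 2; rewrite e cE addrK sreflR //; split=> //.
    by rewrite lexx andbT /c0; zlia.
  by constructor 1; rewrite fix_ //; zlia.
- constructor 2; rewrite fix_ //; try zlia.
  by split=> //; zlia.
- constructor 3; have [e|ne] := eqVneq (g0 i) c0.
    rewrite e sreflL // -cE; split; [zlia|done|zlia|by right|].
    move=> t tc; have [->//|tc0] := eqVneq t c0.
    by apply: gB; zlia.
  have gA' : cls (g0 i) \notin A by case: gA => // e; rewrite e eqxx in ne.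
  rewrite fix_ //; try zlia.
  by split; [zlia|done|zlia|by left|done].
Qed.

Lemma cls_addn i : cls (i + n%:Z) = cls i.
Proof. by apply/eqP; rewrite Zint_eq // modzDr. Qed.

Lemma left_word_links_spec A q : cls q \notin A ->
  rot_spec A (left_word (links (q + 1) n.-1 A) (1%g : affperm n)).
Proof.
move=> qA; set g := left_word _ _.
have n0 : 0 < n%:Z by rewrite ltz_nat ltnW.
have H i : q < i <= q + n -> cls (i - 1) \in A /\ g i = i - 1 \/
  [/\ cls (i - 1) \notin A, i <= g i, cls (g i) \notin A
    & forall t, i <= t < g i -> cls t \in A].
  move=> iq; have kn : (n.-1 < n)%N by rewrite prednK // ltnW.
  have := left_word_links_window qA kn iq; rewrite -/g /= => -[[c _]|[_ iA ->]|[_ iA gi gA gB]].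
  - by zlia.
  - by left.
  right; split=> //; first by zlia.
  case: gA => // ->; rewrite (_ : q + n.-1%:Z + 1 = q + n%:Z); first by rewrite cls_addn.
  by zlia.
move=> i; pose y := ((i - q - 1) %% n)%Z.
have [k iE] : exists k : int, i = q + 1 + y + k * n.
  by exists ((i - q - 1) %/ n)%Z; have := divz_eq (i - q - 1) n; rewrite -/y; zlia.
have clsD z : cls (z + k * n) = cls z by apply/eqP; rewrite Zint_eq // eqmodD.
have y0 : 0 <= y by apply: modz_ge0; rewrite lt0r_neq0.
have yn : y < n by apply: ltz_pmod.
rewrite iE affpermD addrAC clsD.
have [|[iA gE]|[iA gi gA gB]] := H (q + 1 + y); first by zlia.
  by left; rewrite gE; split=> //; ring.
right; rewrite clsD lerD2r; split=> // t tt; rewrite -(subrK (k * n) t) clsD.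
by apply: gB; rewrite lerBrDr ltrBlDr.
Qed.

End CyclicallyDecreasing.

(** * Runs of a subset and cyclically decreasing elements *)

Section CyclicSets.
Variable n : nat.
Hypothesis n_gt1 : (1 < n)%N.
Implicit Types (i m p q s t : int) (u v w : affperm n).
Implicit Types (k j : nat) (A I J : {set 'Z_n}) (a b x : 'Z_n).
Local Notation cls i := (i%:~R : 'Z_n).
Local Notation rep a := (Posz (nat_of_ord a)).

Lemma cls_rep a : cls (rep a) = a. Proof. exact: natr_Zp. Qed.

Lemma cdist_lt a b : (cdist a b < n)%N.
Proof. by have := ltn_ord (b - a); rewrite [X in (_ < X)%N]Zp_cast. Qed.

Lemma cdistK a b : a + (cdist a b)%:R = b.
Proof. by rewrite /cdist natr_Zp addrC subrK. Qed.

Lemma Zp_natr_inj j k : (j < n)%N -> (k < n)%N -> j%:R = k%:R :> 'Z_n -> j = k.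
Proof.
move=> jn kn /(congr1 (fun x : 'Z_n => nat_of_ord x)).
by rewrite !val_Zp_nat // !modn_small.
Qed.

Lemma cdist_addn a k : (k < n)%N -> cdist a (a + k%:R) = k.
Proof.
move=> kn; apply: Zp_natr_inj => //; first exact: cdist_lt.
by apply: (addrI a); rewrite cdistK.
Qed.

Lemma in_cinterval a b x :
  reflect (exists2 k, (k <= cdist a b)%N & x = a + k%:R) (x \in cinterval a b).
Proof.
apply: (iffP imsetP) => [[k]|[k kd ->]].
  by rewrite inE => kd ->; exists k.
have kn : (k < n)%N by apply: leq_ltn_trans kd (cdist_lt a b).
by exists (Ordinal kn); rewrite ?inE.
Qed.

(** Maximality in local form: both neighbours of the interval are gaps of [A]. *)
Definition run A (ab : 'Z_n * 'Z_n) : Prop :=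
  [/\ cinterval ab.1 ab.2 \subset A, ab.1 - 1 \notin A & ab.2 + 1 \notin A].

Lemma cdist_full a b : (cdist a b).+1 = n -> cinterval a b = [set: 'Z_n]%SET.
Proof.
move=> dn; apply/setP => x; rewrite finset.inE; apply/in_cinterval.
by exists (cdist a x); rewrite ?cdistK // -ltnS dn cdist_lt.
Qed.

(** Otherwise the interval could be extended by a neighbour, or would be the
    full cycle. *)
Lemma max_cinterval_run A a b : A \proper [set: 'Z_n]%SET ->
  max_cinterval A (cinterval a b) -> run A (a, b).
Proof.
move=> pA /maxsetP[/andP[_ IA] Imax].
have dn : ((cdist a b).+1 < n)%N.
  rewrite ltn_neqAle cdist_lt andbT; apply/eqP => /cdist_full IT.
  by move: pA; rewrite -IT properE IA andbF.
have bE := cdistK a b; set d := cdist a b in dn bE.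
have memI k : (k <= d)%N -> a + k%:R \in cinterval a b.
  by move=> kd; apply/in_cinterval; exists k.
have inA k : (k <= d)%N -> a + k%:R \in A by move/memI; exact: (fintype.subsetP IA).
have max a' b' : cinterval a' b' \subset A -> cinterval a b \subset cinterval a' b' ->
    cinterval a' b' = cinterval a b.
  move=> JA IJ; apply: Imax => //; rewrite JA andbT.
  by apply/existsP; exists a'; apply/existsP; exists b'.
split=> //=; apply/negP => abA.
  have d' : cdist (a - 1) b = d.+1.
    have -> : b = a - 1 + d.+1%:R by rewrite -[LHS]bE -natr1; ring.
    exact: cdist_addn.
  have E : cinterval (a - 1) b = cinterval a b.
    apply: max; apply/fintype.subsetP => x /in_cinterval[k kd ->].
      case: k kd => [|k]; first by rewrite addr0.
      rewrite d' ltnS => /inA; rewrite -natr1.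
      by rewrite (_ : a - 1 + (k%:R + 1) = a + k%:R) //; ring.
    apply/in_cinterval; exists k.+1; first by rewrite d'.
    by rewrite -natr1; ring.
  have : a - 1 \in cinterval (a - 1) b by apply/in_cinterval; exists 0%N; rewrite ?addr0.
  rewrite E => /in_cinterval[k kd] /addrI k1.
  suff: k.+1 = 0%N by [].
  by apply: Zp_natr_inj; rewrite ?(leq_ltn_trans _ dn) // -natr1 -k1 addNr.
have d' : cdist a (b + 1) = d.+1.
  have -> : b + 1 = a + d.+1%:R by rewrite -bE -natr1; ring.
  exact: cdist_addn.
have E : cinterval a (b + 1) = cinterval a b.
  apply: max; apply/fintype.subsetP => x /in_cinterval[k kd ->].
    rewrite d' leq_eqVlt ltnS in kd; case/orP: kd => [/eqP ->|]; last exact: inA.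
    by rewrite -natr1 addrA bE.
  by apply/in_cinterval; exists k => //; rewrite d' (leq_trans kd).
have : b + 1 \in cinterval a (b + 1) by apply/in_cinterval; exists d.+1; rewrite ?d' // -natr1 addrA bE.
rewrite E => /in_cinterval[k kd]; rewrite -bE -addrA natr1 => /addrI/Zp_natr_inj.
by rewrite (leq_ltn_trans kd (ltnW dn)) dn => /(_ isT isT) dk; rewrite -dk ltnn in kd.
Qed.

Lemma max_cinterval_exists A x : x \in A ->
  exists a b, max_cinterval A (cinterval a b) /\ x \in cinterval a b.
Proof.
move=> xA.
have x0 : cdist x x = 0%N by rewrite /cdist subrr.
have xx : x \in cinterval x x by apply/in_cinterval; exists 0%N; rewrite ?addr0.
have P0 : is_cinterval (cinterval x x) && (cinterval x x \subset A).
  apply/andP; split; first by apply/existsP; exists x; apply/existsP; exists x.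
  by apply/fintype.subsetP => y /in_cinterval[k]; rewrite x0 leqn0 => /eqP -> ->; rewrite addr0.
have [J /[dup] mJ /maxsetp /andP[/existsP[a /existsP[b /eqP JE]] _] sJ] 
  := @maxset_exists _ (fun J : {set 'Z_n} => is_cinterval J && (J \subset A)) _ P0.
by exists a, b; rewrite -JE; split=> //; apply: (fintype.subsetP sJ).
Qed.

Lemma run_succ A ab x : run A ab -> x \in cinterval ab.1 ab.2 -> x + 1 \in A ->
  x + 1 \in cinterval ab.1 ab.2.
Proof.
case: ab => a b [/= _ _ bA] /in_cinterval[k kd ->] xA.
move: kd; rewrite leq_eqVlt => /orP[/eqP kE|kd].
  by move: bA; rewrite -(cdistK a b) -kE xA.
by apply/in_cinterval; exists k.+1 => //; rewrite -natr1 addrA.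
Qed.

Lemma run_le A a b a' b' k k' : run A (a, b) -> run A (a', b') ->
  (k' <= cdist a' b')%N -> a + k%:R = a' + k'%:R -> (k' <= k)%N.
Proof.
move=> [/= _ aA _] [/= I'A _ _] kd' e; rewrite leqNgt; apply/negP => lt.
move/negP: aA; apply; apply: (fintype.subsetP I'A); apply/in_cinterval.
exists (k' - k.+1)%N; first by rewrite (leq_trans (leq_subr _ _)).
apply: (addIr (k.+1%:R)); rewrite -[RHS]addrA -natrD subnK // -e -natr1; ring.
Qed.

Lemma run_unique A ab ab' x : run A ab -> run A ab' ->
  x \in cinterval ab.1 ab.2 -> x \in cinterval ab'.1 ab'.2 -> ab = ab'.
Proof.
case: ab ab' => a b [a' b'] R R' /in_cinterval[k /= kd ->] /in_cinterval[k' /= kd' e].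
have kk : k = k'.
  by apply/eqP; rewrite eqn_leq (run_le R' R kd (esym e)) (run_le R R' kd' e).
move: e; rewrite kk => /addIr aa; subst a'.
suff dd : cdist a b = cdist a b' by rewrite -(cdistK a b) dd cdistK.
have lt c c' : run A (a, c) -> run A (a, c') -> (cdist a c <= cdist a c')%N.
  move=> [/= IA _ _] [/= _ _ cA']; rewrite leqNgt; apply/negP => lt.
  move/negP: cA'; apply; apply: (fintype.subsetP IA); apply/in_cinterval.
  by exists (cdist a c').+1 => //; rewrite -natr1 addrA cdistK.
by apply/eqP; rewrite eqn_leq !lt.
Qed.

Lemma left_word_iota a k : left_word [seq rep a + j%:Z | j <- iota 0 k] (1%g : affperm n) =
  (\prod_(j <- rev (iota 0 k)) simple_refl (a + j%:R)%R)%g.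
Proof.
elim: k => [|k IH]; first by rewrite big_nil.
rewrite -[k.+1]addn1 iotaD map_cat left_word_cat IH rev_cat big_cat /= big_seq1.
congr (_ * _)%g; rewrite -[a + _]/(a + k%:R) -simple_reflE //; congr simple_refl.
by rewrite rmorphD /= cls_rep.
Qed.

Lemma c_interval_spec A a b : A \proper [set: 'Z_n]%SET -> run A (a, b) ->
  rot_spec (cinterval a b) (c_interval a b).
Proof.
move=> pA [/= IA aA bA].
have dn : ((cdist a b).+1 < n)%N.
  rewrite ltn_neqAle cdist_lt andbT; apply/eqP => /cdist_full IT.
  by move: pA; rewrite -IT properE IA andbF.
have aI : cls (rep a - 1) \notin cinterval a b.
  by rewrite rmorphB /= cls_rep; apply: contra aA; exact: fintype.subsetP.
have := left_word_links_spec n_gt1 aI; rewrite subrK.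
suff -> : links (rep a) n.-1 (cinterval a b) = [seq rep a + j%:Z | j <- iota 0 (cdist a b).+1].
  by rewrite left_word_iota.
have -> : n.-1 = ((cdist a b).+1 + (n.-1 - (cdist a b).+1))%N by zlia.
rewrite links_cat // [X in _ ++ X](_ : _ = [::]) ?cats0.
  rewrite /links; apply/all_filterP/allP => i /mapP[j]; rewrite mem_iota /= => jd ->.
  by apply/in_cinterval; exists j => //; rewrite rmorphD /= cls_rep.
rewrite /links; apply/eqP; rewrite -[_ == _]negbK -has_filter; apply/hasPn => i /mapP[j].
rewrite mem_iota /= => jd ->; apply/in_cinterval => -[k kd].
rewrite !rmorphD /= cls_rep -addrA => /addrI; rewrite -natrD => /Zp_natr_inj.
by move=> e; have := e _ _; zlia.
Qed.

Lemma rot_spec_fix I g i : rot_spec I g -> cls i \notin I -> cls (i - 1) \notin I -> g i = i.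
Proof.
move=> G iI iI'; case: (G i) => [[]|[_ gi _ gB]]; first by rewrite (negPf iI').
by apply/eqP; rewrite eq_le gi andbT leNgt; apply/negP => lt; rewrite gB ?lexx // in iI.
Qed.

(** The factors after the moving one fix [i] and those before it fix the image of
    [i]; hence the two conditions. *)
Lemma prod_single (T : eqType) (r : seq T) (P : pred T) (F : T -> affperm n) (x0 : T) i :
    uniq r -> x0 \in r -> P x0 ->
    (forall x : T, P x -> x != x0 -> F x i = i /\ F x (F x0 i) = F x0 i) ->
  (\prod_(x <- r | P x) F x)%g i = F x0 i.
Proof.
move=> ur x0r Px0 H.
have fixI (s : seq T) : {in s, forall x : T, P x -> F x i = i} -> (\prod_(x <- s | P x) F x)%g i = i.
  elim: s => [|x s IH] sF; first by rewrite big_nil affperm1.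
  rewrite big_cons; have IHs : (\prod_(x <- s | P x) F x)%g i = i.
    by apply: IH => y ys; apply: sF; rewrite in_cons ys orbT.
  by case: ifP => // Px; rewrite affpermM IHs sF ?mem_head.
elim: r ur x0r => // x r IH /= /andP[xr ur]; rewrite in_cons big_cons.
have [e _|ne /= x0r] := eqVneq x0 x.
  rewrite -e in xr *; rewrite Px0 affpermM fixI // => y yr Py; apply: (H y Py _).1.
  by apply: contra xr => /eqP <-.
case: ifP => Px; last exact: IH.
by rewrite affpermM IH //; apply: (H x Px _).2; rewrite eq_sym.
Qed.

Lemma prod_fix (T : Type) (r : seq T) (P : pred T) (F : T -> affperm n) i :
  (forall x : T, P x -> F x i = i) -> (\prod_(x <- r | P x) F x)%g i = i.
Proof.
by move=> H; elim/big_rec: _ => [|x w Px wi]; rewrite ?affperm1 // affpermM wi H.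
Qed.

(** The factors of [c_set A] belong to distinct runs, which are separated by gaps:
    the factor of the run that contains [i - 1] or [i] moves [i] as prescribed, and
    all others fix [i] and its image. *)
Lemma c_set_spec A : A \proper [set: 'Z_n]%SET -> rot_spec A (c_set A).
Proof.
move=> pA i; pose P (ab : 'Z_n * 'Z_n) := max_cinterval A (cinterval ab.1 ab.2).
have PR ab : P ab -> run A ab by case: ab => a b /(max_cinterval_run pA).
have spec ab : P ab -> rot_spec (cinterval ab.1 ab.2) (c_interval ab.1 ab.2).
  by case: ab => a b /PR/(c_interval_spec pA).
have fixed ab y : P ab -> cls y \notin cinterval ab.1 ab.2 ->
    cls (y - 1) \notin cinterval ab.1 ab.2 -> c_interval ab.1 ab.2 y = y.
  by move=> /spec; exact: rot_spec_fix.
have exP x : x \in A -> exists2 ab, P ab & x \in cinterval ab.1 ab.2.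
  by move=> /max_cinterval_exists[a [b [m xab]]]; exists (a, b).
have succ y : cls y = cls (y - 1) + 1 by rewrite -{1}(subrK 1 y) rmorphD.
(* two runs do not share or touch elements *)
have sep ab ab' y : P ab -> P ab' -> ab' != ab -> cls y \in cinterval ab.1 ab.2 ->
    cls y \notin cinterval ab'.1 ab'.2 /\ cls (y - 1) \notin cinterval ab'.1 ab'.2.
  move=> Pab Pab' ne yab; split; apply/negP => yab'.
    by case/eqP: ne; apply: run_unique yab' yab; exact: PR.
  have yA : cls y \in A by have [IA _ _] := PR _ Pab; apply: (fintype.subsetP IA).
  have : cls y \in cinterval ab'.1 ab'.2.
    by rewrite succ; apply: run_succ (PR _ Pab') yab' _; rewrite -succ.
  by move=> yab2; case/eqP: ne; apply: run_unique yab2 yab; exact: PR.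
have sep' ab ab' y : P ab -> P ab' -> ab' != ab -> cls (y - 1) \in cinterval ab.1 ab.2 ->
    cls y \notin A -> cls y \notin cinterval ab'.1 ab'.2 /\ cls (y - 1) \notin cinterval ab'.1 ab'.2.
  move=> Pab Pab' ne yab yA; split; last by have [] := sep _ _ _ Pab Pab' ne yab.
  by apply: contra yA; have [IA _ _] := PR _ Pab'; exact: fintype.subsetP.
have [iA|iA] := boolP (cls (i - 1) \in A).
  left; split=> //; have [ab Pab iab] := exP _ iA.
  have gi : c_interval ab.1 ab.2 i = i - 1 by case: (spec _ Pab i) => [[]|[]] //; rewrite iab.
  rewrite /c_set (@prod_single _ _ P _ ab) ?index_enum_uniq ?mem_index_enum //.
  move=> ab' Pab' ne; rewrite gi.
  have [n1 n2] := sep _ _ _ Pab Pab' ne iab.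
  split; last exact: fixed.
  apply: fixed => //; apply/negP => iab'; have ne' : ab != ab' by rewrite eq_sym.
  by have [_] := sep _ _ _ Pab' Pab ne' iab'; rewrite iab.
right; have [iA'|iA'] := boolP (cls i \in A); last first.
  rewrite [c_set A i]prod_fix; first by split=> // t; zlia.
  by move=> ab Pab; have [IA _ _] := PR _ Pab; apply: fixed => //;
    [apply: contra iA'|apply: contra iA]; exact: fintype.subsetP.
have [ab Pab iab] := exP _ iA'; have [IA _ bA] := PR _ Pab.
have niab : cls (i - 1) \notin cinterval ab.1 ab.2 by apply: contra iA; exact: fintype.subsetP.
have [[]|[_ gi gI gB]] := spec _ Pab i; first by rewrite (negPf niab).
set g := c_interval _ _ i in gi gI gB.
have ig : i < g by rewrite lt_neqAle gi andbT; apply: contra gI => /eqP <-.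
have g1I : cls (g - 1) \in cinterval ab.1 ab.2 by apply: gB; clear - ig; zlia.
have gA : cls g \notin A.
  by apply: contra gI; rewrite succ; exact: run_succ (PR _ Pab) g1I.
suff -> : c_set A i = g.
  by split=> // t tg; apply: (fintype.subsetP IA); exact: gB.
rewrite /c_set (@prod_single _ _ P _ ab) ?index_enum_uniq ?mem_index_enum //.
move=> ab' Pab' ne; rewrite -/g; split.
  by have [n1 n2] := sep _ _ _ Pab Pab' ne iab; exact: fixed.
by have [n1 n2] := sep' _ _ _ Pab Pab' ne g1I gA; exact: fixed.
Qed.

(** Any gap of [A] yields the same cyclically decreasing element. *)
Lemma left_word_links_c_set A q u : A \proper [set: 'Z_n]%SET -> cls q \notin A ->
  left_word (links (q + 1) n.-1 A) u = (c_set A * u)%g.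
Proof.
move=> pA qA; rewrite left_word_mul; congr (_ * u)%g; apply: affperm_eq.
exact: rot_spec_uniq (left_word_links_spec n_gt1 qA) (c_set_spec pA).
Qed.

(** The set [A] can be read off from the values that move down. *)
Lemma c_set_inj A A' : A \proper [set: 'Z_n]%SET -> A' \proper [set: 'Z_n]%SET ->
  c_set A = c_set A' -> A = A'.
Proof.
move=> pA pA' e.
have memE (B : {set 'Z_n}) x : B \proper [set: 'Z_n]%SET -> (x \in B) = (c_set B (rep x + 1) < rep x + 1).
  move=> pB; case: (c_set_spec pB (rep x + 1)); rewrite addrK cls_rep.
    by move=> [-> ->]; zlia.
  by move=> [/negPf-> + _ _]; zlia.
by apply/setP => x; rewrite !memE // e.
Qed.

End CyclicSets.

(** * The weak operator as a sum over weak strips *)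

Section WeakSum.
Variable n : nat.
Hypothesis n_gt1 : (1 < n)%N.
Implicit Types (i m p q s t : int) (u v w : affperm n).
Local Notation V := (nat -> nat -> affperm n -> int).
Implicit Types (f g : V) (r k j : nat) (A : {set 'Z_n}) (x : 'Z_n).
Local Notation len := (@aff_length n).
Local Notation cls i := (i%:~R : 'Z_n).
Local Notation cls_segment := (@cls_segment n).
Local Notation weak_prod := (@weak_prod n).
Local Notation dd := (@weak_run n).
Local Notation Lam := (@weak_segment n).

Lemma cls_offset p x : exists2 j, (j < n)%N & x = cls (p + j%:Z).
Proof.
have n0 : 0 < n%:Z by rewrite ltz_nat ltnW.
have y0 := modz_ge0 (Posz (x : nat) - p) (lt0r_neq0 n0).
have yn := ltz_pmod (Posz (x : nat) - p) n0.
have := divz_eq (Posz (x : nat) - p) n.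
move: (divz _ _) (modz _ _) y0 yn => k y y0 yn E; exists `|y|%N; first by zlia.
rewrite -{1}[x]cls_rep; apply/eqP; rewrite Zint_eq //.
have -> : Posz (x : nat) = p + y + k * n by rewrite -addrA [y + _]addrC -E; ring.
by rewrite gez0_abs // eqmodD.
Qed.

Lemma cls_inj p j k : (j < n)%N -> (k < n)%N -> cls (p + j%:Z) = cls (p + k%:Z) -> j = k.
Proof.
move=> jn kn e; case: (ltngtP j k) => // lt; exfalso.
  by apply: (@cls_neq n n_gt1 p j k) => //; zlia.
by apply: (@cls_neq n n_gt1 p k j) => //; zlia.
Qed.

Lemma cls_segment_complement p j x : (j < n)%N ->
  (x \in cls_segment (p + j%:Z + 1) (n - j.+1)) = (x != cls (p + j%:Z)) && (x \notin cls_segment p j).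
Proof.
move=> jn; have [k kn ->] := cls_offset p x.
apply/in_cls_segment/andP => // [[t tn e]|[kj /in_cls_segment]].
  have {e} : cls (p + k%:Z) = cls (p + (j + t.+1)%N%:Z) by rewrite e; congr (cls _); zlia.
  move/(cls_inj kn) => -> //; last by zlia.
  split; last (apply/in_cls_segment => // -[j' j'j] /cls_inj e; have := e _ _; zlia).
  by apply/eqP => /cls_inj e; have := e _ _; zlia.
move=> /(_ n_gt1) np; exists (k - j.+1)%N.
  have : k != j by apply: contra kj => /eqP ->.
  have : ~~ (k < j)%N by apply/negP => kj'; apply: np; exists k.
  by zlia.
have : ~~ (k < j)%N by apply/negP => kj'; apply: np; exists k.
have : k != j by apply: contra kj => /eqP ->.
by move=> ? ?; congr (cls _); zlia.
Qed.

Lemma size_links s k A : (k <= n)%N -> size (links s k A) = #|(A :&: cls_segment s k)%SET|.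
Proof.
elim: k s => [|k IH] s kn; first by rewrite finset.setI0 cards0.
rewrite linksS /=; have := head_notin_cls_segment n_gt1 s kn.
have [sA sW|sA _] := boolP (cls s \in A).
  have -> : (A :&: (cls s |: cls_segment (s + 1) k) = cls s |: (A :&: cls_segment (s + 1) k))%SET.
    by rewrite finset.setIUr (finset.setIidPr _) // finset.sub1set.
  by rewrite cardsU1 finset.in_setI (negPf sW) andbF /= IH // ltnW.
rewrite IH ?(ltnW kn) // finset.setIUr (_ : A :&: [set cls s] = finset.set0)%SET.
  by rewrite finset.set0U.
by apply/setP => x; rewrite !finset.inE; case: eqP => [->|]; rewrite ?(negPf sA) ?andbF.
Qed.

(** The sum of [F z] over the weak strips from [u] to [z] of size [r]. Indexing by the
    sets [A] is faithful because of [c_set_inj]. *)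
Definition weak_sum r (F : affperm n -> int) u : int :=
  \sum_(A : {set 'Z_n} | (A \proper [set: 'Z_n]%SET) && (#|A| == r))
    if len (c_set A * u)%g == (len u + r)%N then F (c_set A * u)%g else 0.

(** The first gap of [A], counted from [p], is at distance [j]. *)
Definition gap_at p j A := (cls_segment p j \subset A) && (cls (p + j%:Z) \notin A).

Lemma gap_unique p j k A : gap_at p j A -> gap_at p k A -> (k <= j)%N.
Proof.
move=> /andP[_ pj] /andP[/fintype.subsetP pk _]; rewrite leqNgt; apply/negP => jk.
by move/negP: pj; apply; apply: pk; apply/in_cls_segment => //; exists j.
Qed.

Lemma sum_gap_at p A (F : int) :
  \sum_(j < n | gap_at p j A) F = if A \proper [set: 'Z_n]%SET then F else 0.
Proof.
case: ifP => pA; last first.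
  rewrite big_pred0 // => j; apply/negP => /andP[_ pj]; move/negP: pA; apply.
  by rewrite properT; apply/eqP => AT; rewrite AT finset.inE in pj.
have [x xA] : exists x, x \notin A.
  by case/properP: pA => _ [x _ xA]; exists x.
have ex : exists j, (j < n)%N && (cls (p + j%:Z) \notin A).
  by have [j jn xE] := cls_offset p x; exists j; rewrite jn -xE.
case: (ex_minnP ex) => j /andP[jn jA] jmin.
have gj : gap_at p j A.
  rewrite /gap_at jA andbT; apply/fintype.subsetP => y /(in_cls_segment n_gt1)[k kj ->].
  apply/negPn/negP => kA; have := jmin k; rewrite kA (ltn_trans kj jn) => /(_ isT).
  by rewrite leqNgt kj.
rewrite (big_pred1 (Ordinal jn)) // => i /=; apply/idP/eqP => [gi|->//].
by apply/val_inj/eqP; rewrite /= eqn_leq (gap_unique gi gj) (gap_unique gj gi).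
Qed.

Lemma dd_weak_prod s k : dd s k = weak_prod [seq s + j%:Z | j <- iota 0 k].
Proof.
rewrite /weak_prod; elim: k s => [|k IH] s; first by rewrite big_nil.
rewrite [LHS]/= IH /= big_cons addr0; congr (_ * _).
rewrite -[1%N]addn0 iotaDl -map_comp; congr (\prod_(i <- _) _).
by apply: eq_map => j /=; rewrite PoszD addrA.
Qed.

Lemma weak_prod_cat ks ks' : weak_prod (ks ++ ks') = weak_prod ks * weak_prod ks'.
Proof. exact: big_cat. Qed.

Lemma sum_gap_sets p j (R : nmodType) (F : {set 'Z_n} -> R) : (j < n)%N ->
  \sum_(A : {set 'Z_n} | A \subset cls_segment (p + j%:Z + 1) (n - j.+1)) F (A :|: cls_segment p j)%SET =
  \sum_(A : {set 'Z_n} | gap_at p j A) F A.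
Proof.
move=> jn.
rewrite [RHS](reindex_onto (fun A => A :|: cls_segment p j)%SET (fun A => A :\: cls_segment p j)%SET) /=; last first.
  by move=> A /andP[/finset.setIidPr WA _]; rewrite -{2}WA finset.setUC finset.setID.
apply: eq_bigl => A; rewrite /gap_at finset.subsetUr /= finset.in_setU negb_or.
have pj : cls (p + j%:Z) \notin cls_segment p j.
  by apply/in_cls_segment => // -[k kj] /cls_inj e; have := e _ _; zlia.
rewrite pj andbT; apply/fintype.subsetP/andP => [AW|[pA /eqP AE] x xA].
  split; first by apply/negP => /AW; rewrite cls_segment_complement // eqxx.
  apply/eqP/setP => x; rewrite !finset.inE; case xA: (x \in A); last by rewrite andNb.
  by have := AW x xA; rewrite cls_segment_complement // => /andP[_ ->].
rewrite cls_segment_complement //; apply/andP; split.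
  by apply: contra pA => /eqP <-.
by move: xA; rewrite -AE !finset.inE => /andP[].
Qed.

Lemma gap_links p j A : (j < n)%N -> A \subset cls_segment (p + j%:Z + 1) (n - j.+1) ->
  weak_prod (links (p + j%:Z + 1) (n - j.+1) A) * dd p j =
  weak_prod (links (p + j%:Z + 1) n.-1 (A :|: cls_segment p j)%SET).
Proof.
move=> jn AW; have -> : n.-1 = (n - j.+1 + j)%N by zlia.
rewrite links_cat // weak_prod_cat; congr (_ * _).
  suff -> : links (p + j%:Z + 1) (n - j.+1) (A :|: cls_segment p j)%SET = links (p + j%:Z + 1) (n - j.+1) A by [].
  apply: eq_links => k kn; rewrite finset.in_setU orbC.
  have : cls (p + j%:Z + 1 + k%:Z) \in cls_segment (p + j%:Z + 1) (n - j.+1).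
    by apply/in_cls_segment => //; exists k.
  by rewrite cls_segment_complement // => /andP[_ /negPf ->].
rewrite (_ : p + j%:Z + 1 + (n - j.+1)%N%:Z = p + n%:Z); last by zlia.
rewrite dd_weak_prod /weak_prod /links (all_filterP _).
  rewrite !big_map; apply: eq_bigr => k _; apply: d_mod.
  by rewrite addrAC modzDr.
apply/allP => i /mapP[k]; rewrite mem_iota /= => kj ->.
rewrite finset.in_setU addrAC cls_addn //; apply/orP; right.
by apply/in_cls_segment => //; exists k.
Qed.

(** The terms of [weak_at p 1] are indexed by the first gap of [A] after [p]; a proper
    subset has exactly one, and cutting the cycle there shows the cyclically
    decreasing element of [A] as a product of weak steps. *)
Lemma weak_at1E p f r k u : (r < n)%N ->
  weak_at p 1 f r k u = \sum_(m < r.+1) weak_sum m (f (r - m)%N k) u.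
Proof.
move=> rn.
pose E A : int := if (#|A| <= r)%N && (len (c_set A * u)%g == len u + #|A|)%N
  then f (r - #|A|)%N k (c_set A * u)%g else 0.
transitivity (\sum_(j < n) \sum_(A | gap_at p j A) E A).
  rewrite /weak_at endo_sumE.
  have -> : (\sum_(j < n) (Lam (p + j%:Z + 1) (n - j.+1) * 1 * dd p j) f) r k u =
    \sum_(j < n) (Lam (p + j%:Z + 1) (n - j.+1) * 1 * dd p j) f r k u.
    by elim/big_rec2: _ => // j x y _ <-.
  apply: eq_bigr => j _; have jn := ltn_ord j; rewrite mulr1 Lam_subsets ?leq_subr //.
  rewrite mulr_suml -(sum_gap_sets p _ jn) endo_sumE.
  have sumE (P : pred {set 'Z_n}) (F : {set 'Z_n} -> V) :
     (\sum_(A | P A) F A) r k u = \sum_(A | P A) F A r k u.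
    by elim/big_rec2: _ => // A x y _ <-.
  rewrite sumE; apply: eq_bigr => A AW; rewrite gap_links // weak_prodE //.
  have gA : gap_at p j (A :|: cls_segment p j)%SET.
    rewrite /gap_at finset.subsetUr finset.in_setU negb_or /=.
    have -> : cls (p + j%:Z) \notin A.
      by apply/negP => /(fintype.subsetP AW); rewrite cls_segment_complement // eqxx.
    by apply/in_cls_segment => // -[t tj] /cls_inj e; have := e _ _; zlia.
  case/andP: gA => _ pjA; have pA : (A :|: cls_segment p j)%SET \proper [set: 'Z_n]%SET.
    by rewrite properT; apply: contra pjA => /eqP ->; rewrite finset.inE.
  rewrite size_links ?leq_pred // left_word_links_c_set //.
  rewrite (finset.setIidPl _) //; apply/fintype.subsetP => x xA.
  have -> : n.-1 = (n - 1)%N by zlia.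
  have := @cls_segment_complement (p + j%:Z) 0 x (ltnW n_gt1); rewrite addr0 => ->.
  by rewrite /= finset.inE andbT; apply: contra pjA => /eqP <-.
rewrite (exchange_big_dep xpredT) //=.
under eq_bigr => A _ do rewrite sum_gap_at.
rewrite -big_mkcond /= /weak_sum.
rewrite (bigID (fun A => (#|A| < r.+1)%N)) /= [X in _ + X]big1 ?addr0; last first.
  by move=> A /andP[_]; rewrite ltnS /E => /negPf ->.
rewrite (partition_big (fun A => inord #|A| : 'I_r.+1) xpredT) //=.
apply: eq_bigr => m _; apply: eq_big => A.
  rewrite -andbA; congr (_ && _); apply/andP/eqP => [[Ar /eqP <-]|->].
    by rewrite inordK.
  by rewrite ltn_ord inord_val.
move=> /andP[/andP[_ Ar] /eqP mE]; rewrite /E.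
by rewrite -mE inordK // -ltnS Ar.
Qed.

End WeakSum.

(** * The commutation relation for sums over strips *)

Section PieriStep.
Variable n : nat.
Hypothesis n_gt1 : (1 < n)%N.
Variable l : int.
Implicit Types (i m p q s M : int) (u v w : affperm n) (B N : nat).
Local Notation V := (nat -> nat -> affperm n -> int).
Implicit Types (f g : V) (r k j : nat) (A : {set 'Z_n}) (F : affperm n -> int).
Local Notation len := (@aff_length n).

(** The last marking of a strip is the largest one and has no bound, which sets the
    first step of the recursion apart. *)
Definition strong_sum k F u : int :=
  if k is k'.+1 then \sum_(C <- covl l u) strip_sum l k' (marking C) F (ins C) else F u.

Lemma strip_sum_bounded B k M F u : bounded l B u -> B%:Z <= M -> strip_sum l k M F u = strong_sum k F u.
Proof.
case: k => //= k uB BM; rewrite big_seq_cond [RHS]big_seq; apply: eq_bigl => C.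
case Cu: (C \in _) => //=; have [] := covl_bounded n_gt1 uB Cu; zlia.
Qed.

Lemma eq_strip_sum k M F F' u : F =1 F' -> strip_sum l k M F u = strip_sum l k M F' u.
Proof.
by move=> FF; elim: k M u => [|k IH] M u /=; [exact: FF|apply: eq_bigr => C _].
Qed.

Lemma eq_strong_sum k F F' u : F =1 F' -> strong_sum k F u = strong_sum k F' u.
Proof.
by case: k => [|k] FF /=; [exact: FF|apply: eq_bigr => C _; exact: eq_strip_sum].
Qed.

Lemma strip_sum0 k M u : strip_sum l k M (fun=> 0) u = 0.
Proof. by elim: k M u => //= k IH M u; rewrite big1. Qed.

Lemma bounded_left_word B ks u : bounded l B u -> bounded l (B + size ks) (left_word ks u).
Proof.
elim: ks B u => [|i ks IH] B u uB /=; first by rewrite addn0.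
by rewrite -addSnnS; apply: IH; exact: bounded_srefl.
Qed.

Lemma bounded_c_set B A u : A \proper [set: 'Z_n]%SET -> bounded l B u -> bounded l (B + n) (c_set A * u)%g.
Proof.
move=> pA uB; have [x xA] : exists x, x \notin A by case/properP: pA => _ [x _ xA]; exists x.
rewrite -(@left_word_links_c_set n n_gt1 A (Posz (x : nat))) ?cls_rep //.
set ks := links _ _ _; suff le : (B + size ks <= B + n)%N by exact: (bounded_le n_gt1 le (bounded_left_word _ uB)).
rewrite leq_add2l size_links ?leq_pred //.
by apply: leq_trans (max_card _) _; rewrite card_ord Zp_cast.
Qed.

Lemma eq_weak_sum r F F' u :
    (forall A, A \proper [set: 'Z_n]%SET -> F (c_set A * u)%g = F' (c_set A * u)%g) ->
  weak_sum r F u = weak_sum r F' u.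
Proof. by move=> FF; apply: eq_bigr => A /andP[pA _]; rewrite FF. Qed.

Lemma weak_sum0 r u : weak_sum r (fun=> 0) u = 0 :> int.
Proof. by rewrite /weak_sum big1 // => A _; rewrite if_same. Qed.

(** This is [weak_strong] for a function [f] concentrated in degree zero, on a segment
    of markings that contains all the markings that can occur at [u]. *)
Lemma weak_sum_strong_sum r k F u : (r < n)%N ->
  weak_sum r (strong_sum k F) u = strong_sum k (weak_sum r F) u +
    (if r is r'.+1 then if k is k'.+1 then weak_sum r' (strong_sum k' F) u else 0 else 0).
Proof.
move=> rn; have [B uB] := bounded_exists n_gt1 l u.
pose s : int := - (B + n)%N%:Z; pose N := (B + n + (B + n))%N.
pose f : V := fun r k u => if (r == 0)%N && (k == 0)%N then F u else 0.
have sN : s + N%:Z = (B + n)%N%:Z by rewrite /s /N; zlia.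
have f0 r' k' w : f r' k'.+1 w = 0 by rewrite /f andbF.
have DE g r' k' : (r' < n)%N -> (forall j w, bounded l (B + n) w -> g j.+1 k' w = 0) ->
    forall p, weak_at p 1 g r' k' u = weak_sum r' (g 0%N k') u.
  move=> rn' g0 p; rewrite weak_at1E // big_ord_recr /= subnn big1 ?add0r // => m _.
  apply: etrans (weak_sum0 m u); apply: eq_weak_sum => A pA.
  have -> : (r' - m)%N = (r' - m.+1).+1 by have := ltn_ord m; zlia.
  by apply: g0; exact: bounded_c_set.
have TE r' k' w : bounded l (B + n) w ->
    strong_segment n_gt1 l s N f r' k' w = if (r' == 0)%N then strong_sum k' F w else 0.
  move=> wB; rewrite (@strong_segment_strip_sum n n_gt1 l (B + n)) //.
  case: r' => [|r'] /=; last by apply: etrans (strip_sum0 k' (s + N%:Z) w); apply: eq_strip_sum.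
  by rewrite (strip_sum_bounded _ _ wB) ?sN //; apply: eq_strong_sum.
have L r' k' : (r' < n)%N ->
    weak_at (s + N%:Z) 1 (strong_segment n_gt1 l s N f) r' k' u = weak_sum r' (strong_sum k' F) u.
  move=> rn'; rewrite DE // => [|m w wB]; last by rewrite TE.
  by apply: eq_weak_sum => A pA; rewrite TE //; exact: bounded_c_set.
have R : strong_segment n_gt1 l (s + 1) N (weak_at s 1 f) r k u = strong_sum k (weak_sum r F) u.
  have DF w k' : weak_at s 1 f r k' w = if k' is 0 then weak_sum r F w else 0.
    rewrite weak_at1E // big_ord_recr /= subnn big1 ?add0r => [|m _].
      case: k' => [|k']; first by apply: eq_weak_sum.
      by apply: etrans (weak_sum0 r w); apply: eq_weak_sum.
    apply: etrans (weak_sum0 m w); apply: eq_weak_sum => A pA.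
    by rewrite /f; have := ltn_ord m; rewrite -subn_gt0; case: (r - m)%N.
  have sB : s + 1 <= - B%:Z by rewrite /s; zlia.
  rewrite (@strong_segment_strip_sum n n_gt1 l B) //.
  rewrite (strip_sum_bounded _ _ uB); last by zlia.
  by apply: eq_strong_sum => w; rewrite DF.
have := weak_strong n_gt1 (N := N) f r k uB (lexx s).
rewrite R sN lexx => /(_ isT) <-; rewrite -sN L //.
case: r rn {R} => [|r] rn; first by rewrite /= subr0 addr0.
by case: k => [|k]; rewrite /= ?rn ?subr0 ?addr0 // L ?subrK // ltnW.
Qed.

End PieriStep.

(** * Enumeration of strong strips and tableaux *)

Section Enumeration.
Variable n : nat.
Hypothesis n_gt1 : (1 < n)%N.
Variable l : int.
Implicit Types (i m p q s M : int) (u v w : affperm n).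
Implicit Types (r k j K : nat) (C : cover_data n) (Q : strip_data n) (F : affperm n -> int).
Implicit Types (Ts : seq (strip_data n)) (ms : seq nat) (bnd : option int).
Local Notation covl := (covl l).

Definition extend Q C : strip_data n := StripData (start Q) (out C) (rcons (covers Q) C).

Definition below bnd m : bool := if bnd is Some M then m < M else true.

(** The strong strips of size [k] ending at [u] with all markings below a bound,
    or with no bound. *)
Fixpoint strips k bnd u : seq (strip_data n) :=
  if k is k'.+1
  then [seq extend Q C | C <- [seq C <- covl u | below bnd (marking C)],
                         Q <- strips k' (Some (marking C)) (ins C)]
  else [:: StripData u u [::]].

Lemma is_chain_rcons w (cs : seq (cover_data n)) C u :
  is_chain w (rcons cs C) u <-> is_chain w cs (ins C) /\ out C = u.
Proof.
elim: cs w => [|D cs IH] w /=; first by split=> -[->].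
by split=> [[<- /IH[]]|[[<- H] E]] //; split=> //; apply/IH.
Qed.

Lemma sorted_rcons (s : seq int) m :
  sorted <%R (rcons s m) = all (fun x => x < m) s && sorted <%R s.
Proof. by rewrite !(sorted_pairwise lt_trans) pairwise_rcons. Qed.

Lemma mem_strips k bnd u Q : Q \in strips k bnd u <->
  [/\ strong_strip l Q, stop Q = u, strip_size Q = k & all (below bnd) (map (@marking n) (covers Q))].
Proof.
elim: k bnd u Q => [|k IH] bnd u Q.
  rewrite inE; split=> [/eqP ->|]; first by split=> //; split=> // C; rewrite in_nil.
  case: Q => v w cs [[_ /= ch _] wu /size0nil cs0 _]; rewrite /= in ch wu cs0; subst cs.
  by rewrite /= in ch; rewrite ch wu.
split=> [/allpairsPdep[C [Q' [+ Q'C ->]]]|[]].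
  rewrite mem_filter => /andP[qC /(mem_covl n_gt1)[mC oC]].
  have [[cs' ch' so'] st' sz' al'] := (IH _ _ _).1 Q'C.
  split; rewrite /strip_size ?size_rcons /= ?size_rcons; [|done|by rewrite -sz'|].
    split=> /=; last by rewrite map_rcons sorted_rcons al' so'.
      by move=> D; rewrite mem_rcons inE => /orP[/eqP ->|/cs'].
    by apply/is_chain_rcons; rewrite -st'.
  rewrite map_rcons all_rcons qC /=; apply: sub_all al' => m /= mC'.
  by case: bnd qC => //= M; apply: lt_trans.
case: Q => v w cs [/= cs' ch so] wu; rewrite /strip_size /= in ch so cs' wu *; subst w.
case/lastP: cs => // cs C in cs' ch so *; rewrite size_rcons => -[sz].
rewrite map_rcons all_rcons => /andP[qC qcs].
have [ch' oC] := (is_chain_rcons _ _ _ _).1 ch.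
move: so; rewrite map_rcons sorted_rcons => /andP[al so].
apply/allpairsPdep; exists C, (StripData v (ins C) cs); split.
- rewrite mem_filter qC; apply/(mem_covl n_gt1); split=> //; apply: cs'.
  by rewrite mem_rcons mem_head.
- apply/IH; split=> //; split=> // D Dcs; apply: cs'.
  by rewrite mem_rcons inE Dcs orbT.
- by rewrite /extend /= oC.
Qed.

Lemma strips_uniq k bnd u : uniq (strips k bnd u).
Proof.
elim: k bnd u => //= k IH bnd u; apply: allpairs_uniq_dep.
- by rewrite filter_uniq // covl_uniq.
- by move=> C _; exact: IH.
move=> _ _ /allpairsPdep[C [Q [_ QC ->]]] /allpairsPdep[D [R [_ RD ->]]] /=.
rewrite /extend => -[sQR _ /rcons_inj[cQR CD]]; subst D.
have [_ Qs _ _] := (mem_strips _ _ _ _).1 QC; have [_ Rs _ _] := (mem_strips _ _ _ _).1 RD.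
suff -> : Q = R by [].
by case: Q R sQR cQR Qs Rs {QC RD} => [v w cs] [v' w' cs'] /= -> -> -> ->.
Qed.

Lemma sum_strips_below k M F u :
  \sum_(Q <- strips k (Some M) u) F (start Q) = strip_sum l k M F u.
Proof.
elim: k M u => [|k IH] M u /=; first by rewrite big_seq1.
rewrite big_allpairs_dep big_filter; apply: eq_bigr => C _; exact: IH.
Qed.

Lemma sum_strips k F u : \sum_(Q <- strips k None u) F (start Q) = strong_sum l k F u.
Proof.
case: k => [|k] /=; first by rewrite big_seq1.
rewrite big_allpairs_dep big_filter; apply: eq_bigr => C _; exact: sum_strips_below.
Qed.

(** The tableaux of shape [u], as lists of strips; the strips and their sizes
    [ms] are listed from the last one to the first, because the last strip ends at the
    given shape and starts at the shape of the remaining tableau. *)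
Fixpoint tabs ms u : seq (seq (strip_data n)) :=
  if ms is m :: ms' then [seq Q :: Ts | Q <- strips m None u, Ts <- tabs ms' (start Q)]
  else if u == 1%g then [:: [::]] else [::].

Definition tab_count ms u : int := size (tabs ms u).

Lemma tab_count_cons k ms u : tab_count (k :: ms) u = strong_sum l k (tab_count ms) u.
Proof.
rewrite -sum_strips /tab_count /= size_allpairs_dep sumnE big_map.
by rewrite (big_morph Posz PoszD (erefl _)).
Qed.

Lemma tabs_uniq ms u : uniq (tabs ms u).
Proof.
elim: ms u => [|k ms IH] u /=; first by case: ifP.
apply: allpairs_uniq_dep; first exact: strips_uniq.
- by move=> Q _; exact: IH.
by move=> _ _ /allpairsPdep[Q [Ts [_ _ ->]]] /allpairsPdep[R [Ts' [_ _ ->]]] /= [-> ->].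
Qed.

Definition triv_strip u : strip_data n := StripData u u [::].

Lemma strong_triv u : strong_strip l (triv_strip u).
Proof. by split=> // C; rewrite in_nil. Qed.

Lemma size0_triv Q : strong_strip l Q -> strip_size Q = 0%N -> Q = triv_strip (stop Q).
Proof. by case: Q => v w cs [_ /= ch _] /size0nil /= cs0; subst cs; rewrite /= in ch; rewrite ch. Qed.

(** The infinite sequence of strips of a list is completed by empty strips. *)
Fixpoint tab_fun Ts u k : strip_data n :=
  if Ts is Q :: Ts' then
    if (k < size Ts')%N then tab_fun Ts' (start Q) k
    else if k == size Ts' then Q else triv_strip u
  else triv_strip u.

Definition wt_list (m : nat -> nat) K : seq nat := rev (mkseq m K).

Lemma wt_listS (m : nat -> nat) K : wt_list m K.+1 = m K :: wt_list m K.
Proof. by rewrite /wt_list /mkseq -addn1 iotaD map_cat rev_cat. Qed.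

Lemma size_tabs ms u Ts : Ts \in tabs ms u -> size Ts = size ms.
Proof.
elim: ms u Ts => [|k ms IH] u Ts /=; first by case: ifP => // _; rewrite inE => /eqP ->.
by case/allpairsPdep=> Q [Ts' [_ /IH <- ->]].
Qed.

Lemma tab_funP (m : nat -> nat) K u Ts : Ts \in tabs (wt_list m K) u ->
  [/\ forall k, strong_strip l (tab_fun Ts u k), start (tab_fun Ts u 0) = 1%g,
      forall k, start (tab_fun Ts u k.+1) = stop (tab_fun Ts u k),
      forall k, (K <= k)%N -> tab_fun Ts u k = triv_strip u
    & forall k, (k < K)%N -> strip_size (tab_fun Ts u k) = m k].
Proof.
elim: K u Ts => [|K IH] u Ts.
  rewrite /wt_list /=; case: ifP => // /eqP u1; rewrite inE => /eqP -> /=.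
  by split=> // k; exact: strong_triv.
rewrite wt_listS /= => /allpairsPdep[Q [Ts' [/mem_strips[sQ stQ szQ _] + ->]]].
move=> /[dup] /size_tabs; rewrite size_rev size_mkseq => szT /IH[T1 T2 T3 T4 T5].
rewrite /= szT; split.
- by move=> k; do 2?[case: ifP => // _]; exact: strong_triv.
- have [K0|K0] := posnP K; last exact: T2.
  by rewrite K0 /= -T2 T4 // K0.
- move=> k; have [kK|kK|e] := ssrnat.ltngtP k.+1 K.
  + exact: T3.
  + by case: eqP => // _; rewrite stQ.
  + by rewrite -T3 T4 // e.
- by move=> k Kk; rewrite ltnNge (ltnW Kk) /= gtn_eqF.
move=> k; rewrite ltnS leq_eqVlt => /orP[/eqP ->|kK]; first by rewrite ltnn eqxx.
by rewrite kK T5.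
Qed.

Definition tab_list (T : nat -> strip_data n) K : seq (strip_data n) := rev (mkseq T K).

Lemma tab_listS T K : tab_list T K.+1 = T K :: tab_list T K.
Proof. by rewrite /tab_list /mkseq -addn1 iotaD map_cat rev_cat. Qed.

Lemma tab_funK K u Ts : size Ts = K -> tab_list (tab_fun Ts u) K = Ts.
Proof.
elim: K u Ts => [|K IH] u [|Q Ts] // [szT].
rewrite tab_listS /= szT ltnn eqxx -[in RHS](IH (start Q) Ts szT); congr (_ :: rev _).
by apply/eq_in_map => k; rewrite mem_iota /= => ->.
Qed.

Lemma tab_listP (m : nat -> nat) K (T : nat -> strip_data n) :
    (forall k, strong_strip l (T k)) -> start (T 0%N) = 1%g ->
    (forall k, start (T k.+1) = stop (T k)) -> (forall k, strip_size (T k) = m k) ->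
  tab_list T K \in tabs (wt_list m K) (start (T K)).
Proof.
move=> sT T0 TS Tm; elim: K => [|K IH]; first by rewrite T0 /= eqxx mem_head.
rewrite tab_listS wt_listS TS; apply/allpairsPdep; exists (T K), (tab_list T K).
by split=> //; apply/mem_strips; split=> //; apply/allP.
Qed.

Lemma card_fset_set_seq (I : choiceType) (X : set I) (s : seq I) :
  uniq s -> (forall x, X x <-> x \in s) -> #|` fset_set X| = size s.
Proof.
move=> us Xs; have -> : X = [set` s] by apply/seteqP; split=> x /Xs.
have fs : finite_set [set` s] by exact: finite_seq.
apply: perm_size; apply: uniq_perm => // x; rewrite in_fset_set //.
by apply/idP/idP => [/set_mem|/mem_set].
Qed.

Lemma Strong_tab_count u (m : {fsfun nat -> nat with 0%N}) K :
  (forall k, (K <= k)%N -> m k = 0%N) -> Strong l u m = tab_count (wt_list m K) u.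
Proof.
move=> mK; rewrite /Strong /tab_count; congr Posz.
rewrite -(size_map (fun Ts => tab_fun Ts u)); apply: card_fset_set_seq.
  rewrite map_inj_in_uniq ?tabs_uniq // => Ts Ts' /size_tabs sz /size_tabs sz' e.
  rewrite -(tab_funK u (erefl (size Ts))) -(tab_funK u (erefl (size Ts'))) sz sz'.
  by rewrite e.
move=> T; split=> [[[sT T0 TS [N TN]] Tm]|/mapP[Ts /tab_funP[T1 T2 T3 T4 T5] ->]]; last first.
  split; last first.
    by move=> k; have [kK|kK] := ltnP k K; [exact: T5|rewrite T4 // mK].
  by split=> //; exists K => k Kk; rewrite T4.
have triv k : (K <= k)%N -> T k = triv_strip (stop (T k)).
  by move=> Kk; apply: size0_triv; rewrite // Tm mK.
have stopE k : (K <= k)%N -> stop (T k) = u.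
  move=> Kk; have [_ <-] := TN (N + k)%N (leq_addr _ _).
  elim: N {TN} => // N ->; rewrite -TS addSn.
  have : (K <= (N + k).+1)%N by rewrite (leq_trans Kk) // -addSn leq_addl.
  by move=> /triv {1}->.
have Tu k : (K <= k)%N -> T k = triv_strip u by move=> Kk; rewrite triv // stopE.
have TK := tab_listP K sT T0 TS Tm; rewrite Tu // in TK.
apply/mapP; exists (tab_list T K) => //.
have [_ _ _ T4 _] := tab_funP TK.
apply/funext => k; have [kK|kK] := ltnP k K; last by rewrite Tu // T4.
have := tab_funK u (size_tabs TK); rewrite size_rev size_mkseq /tab_list => /(congr1 rev).
rewrite !revK => /(congr1 (fun Ts => nth (triv_strip u) Ts k)).
by rewrite !nth_mkseq.
Qed.

End Enumeration.

(** * The Pieri rule *)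

Section Pieri.
Variable n : nat.
Hypothesis n_gt1 : (1 < n)%N.
Variable l : int.
Implicit Types (u v w z : affperm n) (r k j K : nat) (ms a : seq nat) (A : {set 'Z_n}).
Implicit Types (F : affperm n -> int) (f g : nat -> nat).
Local Notation len := (@aff_length n).
Local Notation tab_count := (@tab_count n l).
Local Notation strong_sum := (@strong_sum n l).

Lemma proper_set0 : (finset.set0 : {set 'Z_n}) \proper [set: 'Z_n]%SET.
Proof. by rewrite finset.properT; apply/eqP => /setP/(_ 0); rewrite !finset.inE. Qed.

Lemma c_set0 : c_set (finset.set0 : {set 'Z_n}) = 1%g.
Proof.
have := @left_word_links_c_set n n_gt1 finset.set0 0 1%g proper_set0.
rewrite finset.inE mulg1 => <- //; rewrite /links.
by rewrite (eq_filter (a2 := pred0)) ?filter_pred0 // => i; rewrite finset.inE.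
Qed.

Lemma weak_sum_size0 F u : weak_sum 0 F u = F u.
Proof.
rewrite /weak_sum (big_pred1 finset.set0) => [|A].
  by rewrite c_set0 mul1g addn0 eqxx.
by rewrite cards_eq0 /=; case: (eqVneq A finset.set0) => [->|_]; rewrite ?andbF ?proper_set0.
Qed.

Lemma strong_sum_linear I (s : seq I) k (F : I -> affperm n -> int) u :
  strong_sum k (fun w => \sum_(x <- s) F x w) u = \sum_(x <- s) strong_sum k (F x) u.
Proof.
have strip M k' w : strip_sum l k' M (fun w => \sum_(x <- s) F x w) w =
    \sum_(x <- s) strip_sum l k' M (F x) w.
  elim: k' M w => //= k' IH M w; rewrite exchange_big /=.
  by apply: eq_bigr => C _; exact: IH.
by case: k => //= k; rewrite exchange_big /=; apply: eq_bigr.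
Qed.

(** Iterating the commutation relation expands the factor [1 / (1 - x y)]. *)
Lemma weak_sum_strong_sums r k F u : (r < n)%N ->
  weak_sum r (strong_sum k F) u =
  \sum_(0 <= e < (minn r k).+1) strong_sum (k - e) (weak_sum (r - e) F) u.
Proof.
elim: r k => [|r IH] k rn.
  by rewrite min0n big_nat1 !subn0 weak_sum_strong_sum // addr0.
rewrite weak_sum_strong_sum // big_nat_recl // !subn0; congr (_ + _).
case: k => [|k]; first by rewrite minn0 big_geq.
by rewrite IH ?(ltnW rn) // minnSS; apply: eq_bigr.
Qed.

(** The exponents of the monomials of degree [r] that divide a given one. *)
Fixpoint divisor_exponents r ms : seq (seq nat) :=
  if ms is m :: ms' then [seq e :: a | e <- index_iota 0 (minn r m).+1, a <- divisor_exponents (r - e) ms']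
  else if r == 0%N then [:: [::]] else [::].

(** The monomial [ms] divided by the monomial [a]. *)
Fixpoint sub_exponents ms a : seq nat :=
  if ms is m :: ms' then if a is e :: a' then (m - e)%N :: sub_exponents ms' a' else ms else [::].

(** The induction passes the weak operator through one strip after the other and ends
    at the indicator function of the identity, which no weak strip of positive size
    reaches. *)
Lemma weak_sum_tab_count r ms u : (r < n)%N ->
  weak_sum r (tab_count ms) u = \sum_(a <- divisor_exponents r ms) tab_count (sub_exponents ms a) u.
Proof.
elim: ms r u => [|m ms IH] r u rn.
  case: r rn => [|r] rn; first by rewrite weak_sum_size0 big_seq1.
  rewrite [RHS]big_nil /weak_sum big1 // => A _; rewrite /tab_count /=.
  case: ifP => // /eqP lA; have [e|//] := eqVneq (c_set A * u)%g 1%g.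
  by move: lA; rewrite e len1; zlia.
have -> : tab_count (m :: ms) = strong_sum m (tab_count ms).
  by apply/funext => w; rewrite tab_count_cons.
rewrite weak_sum_strong_sums // big_allpairs_dep; apply: eq_bigr => e _.
rewrite (eq_strong_sum _ _ (F' := fun w => \sum_(a <- divisor_exponents (r - e) ms) tab_count (sub_exponents ms a) w)).
  by rewrite strong_sum_linear; apply: eq_bigr => a _; rewrite -tab_count_cons.
by move=> w; apply: IH; apply: leq_ltn_trans rn; exact: leq_subr.
Qed.

Lemma mem_divisor_exponents r ms a : (a \in divisor_exponents r ms) = all2 leq a ms && (sumn a == r).
Proof.
elim: ms r a => [|m ms IH] r a.
  by case: a => [|e a]; case: r => [|r] //=; rewrite ?inE.
apply/idP/idP => [/allpairsPdep[e [a' [+ + ->]]]|].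
  rewrite mem_index_iota ltnS leq_min IH /= => /andP[er ->] /andP[-> /eqP ->] /=.
  by rewrite subnKC.
case: a => // e a /andP[/andP[em am] /eqP <-]; apply/allpairsPdep; exists e, a; split=> //.
  by rewrite mem_index_iota /= ltnS leq_min (em : (e <= m)%N) andbT leq_addr.
by rewrite IH (am : all2 _ _ _) /= addKn eqxx.
Qed.

Lemma divisor_exponents_uniq r ms : uniq (divisor_exponents r ms).
Proof.
elim: ms r => [|m ms IH] r; first by rewrite /=; case: ifP.
apply: allpairs_uniq_dep; first exact: iota_uniq.
- by move=> e _; exact: IH.
by move=> _ _ /allpairsPdep[e [a [_ _ ->]]] /allpairsPdep[e' [a' [_ _ ->]]] /= [-> ->].
Qed.

Lemma all2_wt_list f g K :
  reflect (forall k, (k < K)%N -> (f k <= g k)%N) (all2 leq (wt_list f K) (wt_list g K)).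
Proof.
elim: K => [|K IH]; first by constructor.
rewrite !wt_listS /=; apply: (iffP andP) => [[fK /IH fg] k|fg].
  by rewrite ltnS leq_eqVlt => /orP[/eqP ->|/fg].
by split; [exact: fg|apply/IH => k kK; apply: fg; exact: ltnW].
Qed.

Lemma sub_exponents_wt_list f g K : sub_exponents (wt_list f K) (wt_list g K) = wt_list (fun k => f k - g k)%N K.
Proof. by elim: K => // K IH; rewrite !wt_listS /= IH. Qed.

Lemma eq_wt_list f g K : (forall k, (k < K)%N -> f k = g k) -> wt_list f K = wt_list g K.
Proof.
by move=> fg; congr rev; apply/eq_in_map => k; rewrite mem_iota /= => /fg.
Qed.

Lemma sumn_wt_list f K : sumn (wt_list f K) = (\sum_(0 <= k < K) f k)%N.
Proof.
elim: K => [|K IH]; first by rewrite big_geq.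
by rewrite wt_listS /= IH big_nat_recr //= addnC.
Qed.

Lemma size_wt_list f K : size (wt_list f K) = K.
Proof. by rewrite size_rev size_mkseq. Qed.

(** The inverse of [wt_list]. *)
Definition exponent a k : nat := nth 0%N (rev a) k.

Lemma exponent_wt_list f K k : (k < K)%N -> exponent (wt_list f K) k = f k.
Proof. by move=> kK; rewrite /exponent revK nth_mkseq. Qed.

Lemma wt_list_exponent a : wt_list (exponent a) (size a) = a.
Proof. by rewrite /wt_list -size_rev mkseq_nth revK. Qed.

Definition monomial K f : {fsfun nat -> nat with 0%N} :=
  [fsfun k in seq_fset tt (iota 0 K) => f k | 0%N].

Lemma monomialE K f k : monomial K f k = if (k < K)%N then f k else 0%N.
Proof. by rewrite fsfunE seq_fsetE mem_iota. Qed.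

Lemma degree_wt_list (m : {fsfun nat -> nat with 0%N}) K :
  (forall k, (K <= k)%N -> m k = 0%N) -> (\sum_(k <- finsupp m) m k)%N = sumn (wt_list m K).
Proof.
move=> mK; rewrite sumn_wt_list /index_iota subn0 [RHS](bigID (fun k => k \in finsupp m)) /=.
rewrite [X in (_ + X)%N]big1 ?addn0 => [|k /fsfun_dflt //].
rewrite -[RHS]big_filter; apply: perm_big; apply: uniq_perm; first exact: fset_uniq.
  by rewrite filter_uniq // iota_uniq.
move=> k; rewrite mem_filter mem_iota /=; case kf: (k \in _) => //=.
by apply/esym; rewrite ltnNge; apply: contraL kf => /mK; rewrite mem_finsupp => ->; rewrite eqxx.
Qed.

Lemma finsupp_bound (m : {fsfun nat -> nat with 0%N}) :
  exists K, forall k, (K <= k)%N -> m k = 0%N.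
Proof.
exists (\max_(k <- finsupp m) k).+1 => k km; apply: fsfun_dflt.
by apply/negP => kf; move: km; rewrite ltnNge (leq_bigmax_seq (F := id) k).
Qed.

(** The monomials of degree [r] have coefficient one in [h_r], so the product runs
    over the divisors of degree [r] of the given monomial. *)
Lemma ps_mul_complete_hsym r u (m : {fsfun nat -> nat with 0%N}) K :
  (forall k, (K <= k)%N -> m k = 0%N) ->
  ps_mul (complete_hsym r) (Strong l u) m =
  \sum_(a <- divisor_exponents r (wt_list m K)) tab_count (sub_exponents (wt_list m K) a) u.
Proof.
move=> mK; rewrite /ps_mul.
pose phi a := (monomial K (exponent a), monomial K (fun k => m k - exponent a k)%N).
have divP a : a \in divisor_exponents r (wt_list m K) ->
    [/\ size a = K, forall k, (k < K)%N -> (exponent a k <= m k)%N & sumn a = r].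
  rewrite mem_divisor_exponents => /andP[am /eqP sa].
  have sz : size a = K by have := am; rewrite all2E size_wt_list => /andP[/eqP].
  by split=> //; apply/all2_wt_list; rewrite -{1}sz wt_list_exponent.
have phi1 a : size a = K -> wt_list (phi a).1 K = a.
  move=> sz; rewrite -[RHS]wt_list_exponent sz; apply: eq_wt_list => k kK.
  by rewrite monomialE kK.
have phiP a : a \in divisor_exponents r (wt_list m K) -> forall k, m k = ((phi a).1 k + (phi a).2 k)%N.
  move=> /divP[sz am _] k; rewrite !monomialE; case: ltnP => kK; last by rewrite mK.
  by rewrite subnKC // am.
rewrite (@fsbigE _ _ _ _ _ [seq phi a | a <- divisor_exponents r (wt_list m K)]) /=; first last.
- move=> [b c] /= bcm nin; rewrite /complete_hsym; case: eqP => [br|]; last by rewrite mul0r.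
  have bm k : (b k <= m k)%N by rewrite bcm leq_addr.
  have bK k : (K <= k)%N -> b k = 0%N by move=> /mK mk; have := bm k; rewrite mk leqn0 => /eqP.
  move/negP: nin; case; apply/mapP; exists (wt_list b K).
    rewrite mem_divisor_exponents -(degree_wt_list bK) br eqxx andbT.
    by apply/all2_wt_list => k _.
  congr pair; apply/fsfunP => k; rewrite monomialE; case: (ltnP k K) => kK.
  + by rewrite exponent_wt_list.
  + exact: bK.
  + by rewrite exponent_wt_list // bcm addKn.
  + by have := bcm k; rewrite mK // => /esym/eqP; rewrite addn_eq0 => /andP[_ /eqP].
- by move=> _ /mapP[a /phiP ? ->].
- rewrite map_inj_in_uniq ?divisor_exponents_uniq // => a a' /divP[sz _ _] /divP[sz' _ _] e.
  by rewrite -(phi1 a sz) -(phi1 a' sz') e.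
rewrite big_map big_seq_cond [RHS]big_seq; apply: eq_big => [a|a /andP[/divP[sz am sa] _]].
  by apply: andb_idr => /phiP ?; rewrite inE.
rewrite /complete_hsym (degree_wt_list (K := K)) => [|k kK]; last by rewrite monomialE ltnNge kK.
rewrite phi1 // sa eqxx mul1r (@Strong_tab_count n n_gt1 l u _ K) => [|k kK].
  rewrite -{2}(wt_list_exponent a) sz sub_exponents_wt_list; congr (tab_count _ _).
  by apply: eq_wt_list => k kK; rewrite monomialE kK.
by rewrite monomialE ltnNge kK.
Qed.

Lemma sum_weak_strips r F u :
  \sum_(z \in [set z | weak_strip u z r]) F z = weak_sum r F u.
Proof.
pose P A := [&& A \proper [set: 'Z_n]%SET, #|A| == r & len (c_set A * u)%g == (len u + r)%N].
have Pstrip A : A \in P -> weak_strip u (c_set A * u)%g r.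
  by move=> /and3P[pA /eqP <- /eqP lA]; exists A; split=> //; rewrite lA.
rewrite (@fsbigE _ _ _ _ _ [seq (c_set A * u)%g | A <- enum P]) /=.
- rewrite big_map big_enum_cond /= /weak_sum -big_mkcondr; apply: eq_bigl => A.
  by rewrite andb_idr => [|/Pstrip ?]; rewrite ?inE // unfold_in /P andbA.
- rewrite map_inj_in_uniq ?enum_uniq // => A A'; rewrite !mem_enum.
  move=> /andP[pA _] /andP[pA' _] /mulIg; exact: c_set_inj.
- by move=> _ /mapP[A + ->]; rewrite mem_enum; exact: Pstrip.
- move=> z [A [pA Ar -> lA]] /negP; case; apply/map_f.
  by rewrite mem_enum; apply/and3P; rewrite pA Ar eqxx -Ar lA eqxx.
Qed.

End Pieri.

Theorem theorem4p7 (n : nat) (l : int) (u : affperm n) (r : nat)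
    (hn : (2 <= n)%N) (hr : (1 <= r <= n - 1)%N) :
  ps_mul (complete_hsym r) (Strong l u) =
  (\sum_(z \in [set z : affperm n | weak_strip u z r]) Strong l z)%R.
Proof.
have rn : (r < n)%N by zlia.
apply/funext => m; have [K mK] := finsupp_bound m.
rewrite (ps_mul_complete_hsym hn l r u mK) -weak_sum_tab_count // -sum_weak_strips //.
set W := [set z | _].
have fin : finite_set W.
  apply: (@sub_finite_set _ _ [set (c_set A * u)%g | A in [set: {set 'Z_n}]%classic]).
    by move=> z [A [_ _ -> _]]; exists A.
  exact: finite_image.
rewrite !fsbig_finite // fct_sumE; apply: eq_bigr => z _.
by rewrite (Strong_tab_count hn l z mK).
Qed.
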